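(* Let $h:\mathbb{R}\to[0,\infty)$ be a convex function with $h(0)=0$, and let $c:\mathbb{R}^2\times\mathbb{R}^2\to[0,\infty)$ be the separable cost $c(\mathbf{x},\mathbf{y})=h(|x_1-y_1|)+h(|x_2-y_2|)$. Let $\mu,\nu\in\mathcal{P}(\mathbb{R}^2)$ and let $\zeta$ be a pivot measure between $\mu$ and $\nu$ for the cost $c$. Then $$W_c(\mu,\nu)=\int_{\mathbb{R}}\int_{[0,1]}h\big(|F^{[-1]}_{\mu_{|x_2}}(s)-F^{[-1]}_{\zeta_{|x_2}}(s)|\big)\,ds\,d\mu_2(x_2)+\int_{\mathbb{R}}\int_{[0,1]}h\big(|F^{[-1]}_{\zeta_{|y_1}}(t)-F^{[-1]}_{\nu_{|y_1}}(t)|\big)\,dt\,d\nu_1(y_1).$$ In particular, if $h=|\cdot|$, then $$W_1(\mu,\nu)=\int_{\mathbb{R}}\int_{\mathbb{R}}|F_{\mu_{|x_2}}(s)-F_{\zeta_{|x_2}}(s)|\,ds\,d\mu_2(x_2)+\int_{\mathbb{R}}\int_{\mathbb{R}}|F_{\zeta_{|y_1}}(t)-F_{\nu_{|y_1}}(t)|\,dt\,d\nu_1(y_1).$$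
   Context: $\mathcal{P}(Z)$ denotes the Borel probability measures on $Z$; $T_\#$ denotes push-forward; $\mathfrak{p}_A$ denotes the projection onto the factor(s) $A$. Here $X=X_1\times X_2=\mathbb{R}^2$ with points $\mathbf{x}=(x_1,x_2)$ and $Y=Y_1\times Y_2=\mathbb{R}^2$ with points $\mathbf{y}=(y_1,y_2)$, all factors being $\mathbb{R}$. $W_c(\mu,\nu)=\inf_{\pi\in\Pi(\mu,\nu)}\int c\,d\pi$, where $\Pi(\mu,\nu)$ is the set of couplings of $\mu$ and $\nu$; $W_1(\mu,\nu)$ denotes $W_c(\mu,\nu)$ for $c(\mathbf{x},\mathbf{y})=|x_1-y_1|+|x_2-y_2|$. Cardinal flows: $\mathcal{F}(\mu,\nu)$ is the set of pairs $(f^{(1)},f^{(2)})\in\mathcal{P}(X\times Y_1)\times\mathcal{P}(X_2\times Y)$ such that $(\mathfrak{p}_X)_\#f^{(1)}=\mu$, $(\mathfrak{p}_Y)_\#f^{(2)}=\nu$ and $(\mathfrak{p}_{Y_1\times X_2})_\#f^{(1)}=(\mathfrak{p}_{Y_1\times X_2})_\#f^{(2)}$. A cardinal flow is optimal if it minimizes $\int h(|x_1-y_1|)\,df^{(1)}+\int h(|x_2-y_2|)\,df^{(2)}$ over $\mathcal{F}(\mu,\nu)$. A measure $\zeta\in\mathcal{P}(Y_1\times X_2)$ is a pivot measure between $\mu$ and $\nu$ if there is an optimal cardinal flow with $(\mathfrak{p}_{Y_1\times X_2})_\#f^{(1)}=(\mathfrak{p}_{Y_1\times X_2})_\#f^{(2)}=\zeta$.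 (Then the $X_2$-marginal of $\zeta$ is $\mu_2$ and its $Y_1$-marginal is $\nu_1$.) $\mu_2=(\mathfrak{p}_{X_2})_\#\mu$, $\nu_1=(\mathfrak{p}_{Y_1})_\#\nu$. The conditional laws $\mu_{|x_2}\in\mathcal{P}(X_1)$, $\zeta_{|x_2}\in\mathcal{P}(Y_1)$ come from disintegrating $\mu$, $\zeta$ with respect to $x_2$; $\zeta_{|y_1}\in\mathcal{P}(X_2)$, $\nu_{|y_1}\in\mathcal{P}(Y_2)$ come from disintegrating $\zeta$, $\nu$ with respect to $y_1$. For $\rho\in\mathcal{P}(\mathbb{R})$, $F_\rho(t)=\rho((-\infty,t])$ is the cumulative distribution function and $F_\rho^{[-1]}(s)=\inf\{t\in\mathbb{R}:F_\rho(t)\ge s\}$ its pseudo-inverse. *)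

(* Defs.v *)
From HB Require Import structures.
From mathcomp Require Import all_boot all_order all_algebra.
From mathcomp Require Import all_classical all_reals all_analysis.

Set Implicit Arguments.
Unset Strict Implicit.
Unset Printing Implicit Defensive.

Import Order.TTheory GRing.Theory Num.Theory.
Import numFieldNormedType.Exports.

Local Open Scope classical_set_scope.
Local Open Scope ring_scope.

(* The plane is [(R * R)%type] with the product of the Borel sigma-algebras,
   and [P(Z)] is [probability Z R].                                           *)

(* A library measure is a function on all subsets, constrained on measurable
   ones only, so measures are compared on measurable sets and not with [=].   *)
Definition same_measure (d : measure_display) (T : measurableType d)
    (R : realType) (m1 m2 : set T -> \bar R) : Prop :=
  forall A : set T, measurable A -> m1 A = m2 A.

Definition couplings (d1 d2 : measure_display) (S : measurableType d1)
    (T : measurableType d2) (R : realType) (mu : probability S R)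
    (nu : probability T R) : set (probability (S * T)%type R) :=
  [set pi : probability (S * T)%type R |
    same_measure (pushforward pi fst) mu /\
    same_measure (pushforward pi snd) nu].

(* Values are extended reals since the cost need not be integrable. *)
Definition transport_cost (d1 d2 : measure_display) (S : measurableType d1)
    (T : measurableType d2) (R : realType) (c : S -> T -> R)
    (mu : probability S R) (nu : probability T R) : \bar R :=
  ereal_inf [set (\int[pi]_z (c z.1 z.2)%:E)%E | pi in couplings mu nu].

Definition separable_cost (R : realType) (h : R -> R) (x y : R * R) : R :=
  h `|x.1 - y.1| + h `|x.2 - y.2|.

Definition W1 (R : realType) (mu nu : probability (R * R)%type R) : \bar R :=
  transport_cost (fun x y : R * R => `|x.1 - y.1| + `|x.2 - y.2|) mu nu.

(* The first component lives on X * Y1, with points ((x1, x2), y1), the second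
   one on X2 * Y, with points (x2, (y1, y2)).                                 *)
Definition flow_pair (R : realType) : Type :=
  (probability ((R * R) * R)%type R * probability (R * (R * R))%type R)%type.

(* Projections of X * Y1 and of X2 * Y onto Y1 * X2, with points (y1, x2). *)
Definition pivot_proj1 (R : realType) (z : (R * R) * R) : R * R :=
  (z.2, z.1.2).

Definition pivot_proj2 (R : realType) (z : R * (R * R)) : R * R :=
  (z.2.1, z.1).

Definition cardinal_flows (R : realType) (mu nu : probability (R * R)%type R) :
    set (flow_pair R) :=
  [set f : flow_pair R |
    [/\ same_measure (pushforward f.1 fst) mu,
        same_measure (pushforward f.2 snd) nu &
        same_measure (pushforward f.1 (@pivot_proj1 R))
                     (pushforward f.2 (@pivot_proj2 R))]].

Definition flow_cost (R : realType) (h : R -> R) (f : flow_pair R) : \bar R :=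
  (\int[f.1]_z (h `|z.1.1 - z.2|)%:E + \int[f.2]_z (h `|z.1 - z.2.2|)%:E)%E.

Definition optimal_flow (R : realType) (h : R -> R)
    (mu nu : probability (R * R)%type R) (f : flow_pair R) : Prop :=
  cardinal_flows mu nu f /\
  (forall g : flow_pair R, cardinal_flows mu nu g ->
    (flow_cost h f <= flow_cost h g)%E).

Definition is_pivot (R : realType) (h : R -> R)
    (mu nu zeta : probability (R * R)%type R) : Prop :=
  exists f : flow_pair R,
    [/\ optimal_flow h mu nu f,
        same_measure (pushforward f.1 (@pivot_proj1 R)) zeta &
        same_measure (pushforward f.2 (@pivot_proj2 R)) zeta].

(* [k] is a disintegration of [m] with respect to [p], the fibres being
   observed through [q]: for a random element with law [m], [k b] is a version
   of the law of [q] conditionally on [p = b].                                *)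
Definition is_disintegration (d d1 d2 : measure_display)
    (T : measurableType d) (B : measurableType d1) (F : measurableType d2)
    (R : realType) (m : probability T R) (p : T -> B) (q : T -> F)
    (k : R.-pker B ~> F) : Prop :=
  forall (C : set B) (A : set F), measurable C -> measurable A ->
    m (p @^-1` C `&` q @^-1` A) = (\int[pushforward m p]_(b in C) k b A)%E.

(* Distribution function of a law, as opposed to the library's [cdf] of a
   random variable; [fine] is harmless on finite measures.                    *)
Definition law_cdf (R : realType) (rho : {measure set R -> \bar R}) (t : R) :
    R :=
  fine (rho `]-oo, t]%classic).

(* For a probability measure and [0 < s < 1] the set is nonempty and bounded
   below. When it is not (possible only for [s = 0] or [s = 1] within
   [[0, 1]]), [inf] is the real 0, which does not affect integrals in [s].    *)
Definition quantile (R : realType) (rho : {measure set R -> \bar R}) (s : R) :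
    R :=
  inf [set t : R | s <= law_cdf rho t].

(* Main.v *)
Require Import Defs.
From HB Require Import structures.
From mathcomp Require Import all_boot all_order all_algebra.
From mathcomp Require Import all_classical all_reals all_analysis.
From mathcomp Require Import measurable_realfun ring lra.

(* The theorem follows from a chain of three inequalities: the cost of an optimal
   cardinal flow is at most W_c, since projecting a coupling on X * Y1 and X2 * Y
   gives a flow of the same cost; W_c is at most the sum of quantile integrals;
   and this sum is at most the cost of any flow with pivot zeta.

   The last two inequalities rest on the optimality of monotone rearrangements
   conditionally on a variable Z, proved without disintegrating the flow: an
   even convex cost is a limit from below of combinations of hinges
   (|x - y| - g)^+, whose integrals only involve P(X <= t - g, t < Y); if, given
   Z, the pair (X, Y) is carried by a monotone set, these probabilities are
   determined by, and minimal for, the laws of (X, Z) and (Y, Z).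

   For the second inequality one glues the two quantile couplings along zeta:
   if (y1, x2) has law zeta and u is an independent uniform variable, the
   distributional transform s = F(y1-) + u (F(y1) - F(y1-)), with F the
   distribution function of zeta given x2, is uniform given x2, and
   (F_{mu|x2}^{-1}(s), y1) is a monotone coupling given x2. The same is done on
   the other side with a second uniform variable. *)

Set Implicit Arguments.
Unset Strict Implicit.
Unset Printing Implicit Defensive.

Import Order.TTheory GRing.Theory Num.Theory.
Import numFieldNormedType.Exports.

Local Open Scope classical_set_scope.
Local Open Scope ring_scope.

(** * Convex functions as limits of hinges *)

Section convex_on_line.
Variables (R : realType) (h : R -> R).
Hypothesis h_ge0 : forall x : R, 0 <= h x.
Hypothesis h_convex : @convex_function R R^o [set: R] h.
Hypothesis h0 : h 0 = 0.

(** Convexity with denominators cleared: polynomial, hence usable by [nra], and still valid when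
    [x = z]. *)
Lemma convex_three_points (x y z : R) : x <= y -> y <= z ->
  h y * (z - x) <= h x * (z - y) + h z * (y - x).
Proof.
move=> xy yz.
have [xz|] := ltP x z; last first.
  move=> zx; have -> : y = x by lra.
  have -> : z = x by lra.
  lra.
have zx0 : 0 < z - x by lra.
have p0 : 0 <= (z - y) / (z - x) by apply: divr_ge0; lra.
have p1 : (z - y) / (z - x) <= 1 by rewrite ler_pdivrMr// mul1r; lra.
pose p := Itv01 p0 p1.
have := @h_convex p x z; rewrite !inE => /(_ Logic.I Logic.I).
rewrite !convRE /= /unstable.onem.
rewrite [conv _ _ _](_ : _ = y :> R); last first.
  have <- : (z - y) / (z - x) * x + (1 - (z - y) / (z - x)) * z = y by field; lra.
  by [].
rewrite -(ler_pM2r zx0) => /le_trans; apply.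
rewrite le_eqVlt; apply/orP; left; apply/eqP; field; lra.
Qed.

(** The points [0 <= x <= y] and [h 0 = 0] give [h x * y <= h y * x]; then [x <= y] and [0 <= h y]
    conclude. *)
Lemma convex_nondecreasing (x y : R) : 0 <= x -> x <= y -> h x <= h y.
Proof.
move=> x0 xy.
have := convex_three_points x0 xy; rewrite h0 mul0r add0r subr0 => H.
have [y0|] := ltP 0 y; last first.
  by move=> y0; have -> : x = y by lra.
have := h_ge0 y; nra.
Qed.

Lemma convex_secant_below (x y z : R) : x < y -> y <= z ->
  h x + (h y - h x) / (y - x) * (z - x) <= h z.
Proof.
move=> xy yz; have H := convex_three_points (ltW xy) yz.
have yx0 : 0 < y - x by lra.
rewrite -(ler_pM2r yx0).
have -> : (h x + (h y - h x) / (y - x) * (z - x)) * (y - x) =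
  h x * (y - x) + (h y - h x) * (z - x) by field; lra.
move: H; lra.
Qed.

(* The sum over [k < m] of the hinges [(z - (k + 1) d)^+] weighted by the second
   differences of [h] on the grid [d * nat] is the chord of [h] through the
   grid points [m - 1] and [m], shifted to the right by [d]; the shift makes
   it a minorant of [h]. *)
Let slope (d : R) (k : nat) : R :=
  if k is k'.+1 then (h (k'.+1%:R * d) - h (k'%:R * d)) / d else 0.

Let hinge_sum (d : R) (N : nat) (z : R) : R :=
  \sum_(k < N) (slope d k.+1 - slope d k) * Num.max 0 (z - k.+1%:R * d).

Let slope_le (d : R) (k : nat) : 0 < d -> slope d k <= slope d k.+1.
Proof.
move=> d0; case: k => [|k] /=.
  by rewrite mul0r h0 subr0 divr_ge0// ltW.
rewrite ler_pM2r ?invr_gt0//.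
have := @convex_three_points (k%:R * d) (k.+1%:R * d) (k.+2%:R * d).
rewrite !ler_wpM2r ?ler_nat ?(ltW d0)// => /(_ isT isT).
rewrite -!natr1; nra.
Qed.

(** Summation by parts: each new weight changes the slope at the next knot, so that the affine
    pieces join up at increments [slope * d] of [h]. *)
Let hinge_sum_unclipped (d : R) (m : nat) (z : R) : 0 < d ->
  \sum_(k < m.+1) (slope d k.+1 - slope d k) * (z - k.+1%:R * d) =
  h (m%:R * d) + slope d m.+1 * (z - m.+1%:R * d).
Proof.
move=> d0; elim: m => [|m IH].
  by rewrite big_ord_recl big_ord0 /= mul0r h0; ring.
rewrite big_ord_recr /= IH /= -!natr1; field; lra.
Qed.

(** In cell [m] of the grid the hinges of index below [m] are active and the others vanish; the
    alternative [m = N] covers [z] beyond the last knot. *)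
Let hinge_sum_clip (d : R) (m N : nat) (z : R) : 0 < d -> (m <= N)%N ->
  m%:R * d <= z -> (m = N \/ z <= m.+1%:R * d) ->
  hinge_sum d N z = \sum_(k < m) (slope d k.+1 - slope d k) * (z - k.+1%:R * d).
Proof.
move=> d0 mN mz zm; rewrite /hinge_sum -(subnKC mN) big_split_ord /=.
rewrite [X in _ + X]big1 ?addr0 => [|i _].
  apply: eq_bigr => i _; congr (_ * _); apply/max_idPr; rewrite subr_ge0.
  by rewrite (le_trans _ mz)// ler_wpM2r ?(ltW d0)// ler_nat.
case: zm => [mE|zm].
  by have := ltn_ord i; rewrite {2}mE subnn.
have -> : Num.max 0 (z - (m + i).+1%:R * d) = 0; last by rewrite mulr0.
apply/max_idPl; rewrite subr_le0 (le_trans zm)// ler_wpM2r ?(ltW d0)// ler_nat.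
by rewrite ltnS leq_addr.
Qed.

Let grid_cell (d : R) (N : nat) (z : R) : 0 < d -> 0 <= z ->
  exists m : nat, [/\ (m <= N)%N, m%:R * d <= z &
    m = N \/ z <= m.+1%:R * d].
Proof.
move=> d0 z0; elim: N => [|N [m [mN mz [mE|zm]]]].
- by exists 0%N; split => //; [rewrite mul0r|left].
- by have [zN|/ltW zN] := leP (N.+1%:R * d) z;
    [exists N.+1; split => //; left | exists N; split => //; [rewrite -mE|right]].
- by exists m; split => //; [exact: leqW|right].
Qed.

(** A chord extended to the right stays below [h], and shifting it to the right lowers it further
    since its slope is nonnegative. *)
Let hinge_sum_le (d : R) (N : nat) (z : R) : 0 < d -> 0 <= z ->
  hinge_sum d N z <= h z.
Proof.
move=> d0 z0; have [m [mN mz mzN]] := grid_cell N d0 z0.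
rewrite (hinge_sum_clip d0 mN mz mzN).
case: m mN mz mzN => [|m] mN mz mzN; first by rewrite big_ord0.
rewrite hinge_sum_unclipped//.
have md0 : 0 <= m%:R * d by rewrite mulr_ge0// ltW.
have Sm : m.+1%:R * d = m%:R * d + d by rewrite -natr1; ring.
rewrite -/slope Sm in mz *.
have sl0 : 0 <= slope d m.+1.
  by rewrite /= divr_ge0 ?(ltW d0)// subr_ge0 convex_nondecreasing// Sm; lra.
have slE : slope d m.+1 = (h (m%:R * d + d) - h (m%:R * d)) / (m%:R * d + d - m%:R * d).
  by rewrite /slope Sm [_ + d - _]addrC addKr.
have := @convex_secant_below (m%:R * d) (m%:R * d + d) z.
rewrite -slE ltrDl => /(_ d0 mz); apply: le_trans.
by rewrite lerD2l ler_wpM2l//; lra.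
Qed.

(** Between the grid points [m + 1] and [m + 2] the sum is at least [h (m * d)], and [z - 2d] does
    not exceed [m * d]. *)
Let hinge_sum_ge (d : R) (N : nat) (z : R) : 0 < d -> 0 <= z -> z <= N%:R * d ->
  h (Num.max 0 (z - d *+ 2)) <= hinge_sum d N z.
Proof.
move=> d0 z0 zN; have [m [mN mz mzN]] := grid_cell N d0 z0.
rewrite (hinge_sum_clip d0 mN mz mzN).
have {mzN}zm : z <= m.+1%:R * d.
  case: mzN => // mE; rewrite mE (le_trans zN)// ler_wpM2r ?(ltW d0)//.
  by rewrite ler_nat.
case: m mN mz zm => [|m] mN mz zm.
  rewrite big_ord0 (_ : Num.max _ _ = 0) ?h0//.
  by apply/max_idPl; rewrite mul1r in zm; rewrite mulr2n; lra.
rewrite hinge_sum_unclipped//.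
have md0 : 0 <= m%:R * d by rewrite mulr_ge0// ltW.
have Sm : m.+1%:R * d = m%:R * d + d by rewrite -natr1; ring.
have SSm : m.+2%:R * d = m%:R * d + d + d by rewrite -!natr1; ring.
rewrite SSm in zm.
have sl0 : 0 <= slope d m.+1.
  by rewrite /= divr_ge0 ?(ltW d0)// subr_ge0 convex_nondecreasing// Sm; lra.
rewrite -[leLHS]addr0 lerD//; last first.
  by rewrite mulr_ge0// subr_ge0.
apply: convex_nondecreasing; rewrite ?le_max ?lexx// ge_max md0 mulr2n; lra.
Qed.

Lemma convex_hinge_approximation :
  exists (N : nat -> nat) (a g : nat -> nat -> R),
    [/\ (forall n k, 0 <= a n k), (forall n k, 0 <= g n k),
      (forall n z, 0 <= z ->
         \sum_(k < N n) a n k * Num.max 0 (z - g n k) <= h z) &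
      (forall z, 0 <= z ->
         \sum_(k < N n) a n k * Num.max 0 (z - g n k) @[n --> \oo] --> h z)].
Proof.
pose d n : R := n.+1%:R^-1.
have d0 n : 0 < d n by rewrite invr_gt0 ltr0n.
(* With mesh [1 / (n + 1)] and [(n + 1)^2] hinges the knots reach [n + 1], so every fixed [z] is
   eventually covered. *)
exists (fun n => (n.+1 * n.+1)%N), (fun n k => slope (d n) k.+1 - slope (d n) k),
  (fun n k => k.+1%:R * d n); split.
- by move=> n k; rewrite subr_ge0; exact: slope_le.
- by move=> n k; rewrite mulr_ge0// ltW.
- by move=> n z z0; exact: hinge_sum_le.
move=> z z0.
have dcvg : d n @[n --> \oo] --> (0 : R) by exact: cvg_harmonic.
(* The lower bound is a quantitative continuity: by convexity, going from [z] back to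
   [max 0 (z - 2d)] lowers [h] by at most [2d] times its increment over [[z, z + 1]]. *)
apply: (@squeeze_cvgr _ _ _ _
  (fun n => h z - (d n *+ 2) * (h (z + 1) - h z)) (fun=> h z)).
- near=> n; rewrite hinge_sum_le ?andbT//.
  apply: le_trans (hinge_sum_ge (d0 n) z0 _); last first.
    have zn : z <= n.+1%:R.
      apply: ltW; near: n; exists (Num.truncn z).+1 => // n /= zn.
      apply: lt_le_trans (truncnS_gt z) _; rewrite ler_nat; exact: leqW.
    by rewrite /d natrM mulfK// pnatr_eq0.
  have hz1 : h z <= h (z + 1) by apply: convex_nondecreasing; lra.
  have dn := d0 n; rewrite mulr2n.
  have [zd|zd] := leP 0 (z - (d n + d n)).
    have := @convex_three_points (z - (d n + d n)) z (z + 1).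
    set y := h (z - _); move=> /(_ _ _)H.
    have {}H := H ltac:(lra) ltac:(lra).
    have := h_ge0 z; nra.
  have := @convex_three_points 0 z (z + 1) z0 ltac:(lra); rewrite h0.
  nra.
- rewrite -[X in _ --> X]subr0; apply: cvgB; first exact: cvg_cst.
  rewrite -[X in _ --> X](mul0r (h (z + 1) - h z)); apply: cvgMl.
  under eq_fun do rewrite mulr2n.
  by rewrite -[X in nbhs X]addr0; apply: cvgD.
- exact: cvg_cst.
Unshelve. all: by end_near. Qed.

End convex_on_line.

(** * Optimality of monotone rearrangements *)

(** At most one of the two one-sided hinges is nonzero, because [g] is nonnegative. *)
Lemma hinge_distance (R : realType) (x y g : R) : 0 <= g ->
  Num.max 0 (`|x - y| - g) = Num.max 0 (y - x - g) + Num.max 0 (x - y - g).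
Proof.
move=> g0; have [xy|xy] := ler0P (x - y).
  by rewrite opprB [X in _ = _ + X](_ : _ = 0) ?addr0//; apply/max_idPl; lra.
by rewrite [X in _ = X + _](_ : _ = 0) ?add0r//; apply/max_idPl; lra.
Qed.

(** * Layer formula for one-sided hinges *)

Section hinge_layers.
Context d (T : measurableType d) (R : realType) (P : probability T R).
Variables (X Y : T -> R).
Hypotheses (mX : measurable_fun [set: T] X) (mY : measurable_fun [set: T] Y).
Variable g : R.
Local Notation leb := (@lebesgue_measure R).

Let A : set (T * R) := [set z | X z.1 + g <= z.2 /\ z.2 < Y z.1].

Let measurable_layer : measurable A.
Proof.
rewrite (_ : A = [set z | (X z.1 + g <= z.2) && (z.2 < Y z.1)]); last first.
  by apply/seteqP; split => z /=; [move=> [-> ->]|move=> /andP[]].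
rewrite -[X in measurable X]setTI.
have m1 : measurable_fun [set: T * R] (fun z => X z.1 + g <= z.2).
  apply: measurable_fun_ler => //; apply: measurable_funD => //.
  exact: measurableT_comp.
have m2 : measurable_fun [set: T * R] (fun z => z.2 < Y z.1).
  by apply: measurable_fun_ltr => //; exact: measurableT_comp.
exact: (measurable_and m1 m2).
Qed.

Let layerE t : ysection A t = [set w | X w <= t - g /\ t < Y w].
Proof.
apply/seteqP; split => w; rewrite /ysection /= inE /A /=.
  by move=> [Xt tY]; split => //; lra.
by move=> [Xt tY]; split => //; lra.
Qed.

Lemma measurable_hinge_layer :
  measurable_fun [set: R] (fun t => P [set w | X w <= t - g /\ t < Y w]).
Proof.
under eq_fun do rewrite -layerE.
exact: measurable_fun_ysection.
Qed.

(** The hinge [(Y - X - g)^+] is the length of [[X + g, Y[]; Tonelli exchanges this length with the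
    expectation. *)
Lemma integral_hinge_layers :
  (\int[P]_w (Num.max 0 (Y w - X w - g))%:E =
   \int[leb]_t P [set w | (X w <= t - g)%R /\ (t < Y w)%R])%E.
Proof.
have mA : measurable_fun [set: T * R] (fun z => (\1_A z : R)%:E).
  by apply/measurable_EFinP; exact: measurable_indic.
have H := @fubini_tonelli _ _ T _ R P leb (fun z => (\1_A z : R)%:E) mA.
transitivity (\int[P]_x \int[leb]_y (\1_A (x, y))%:E)%E.
  apply: eq_integral => w _.
  rewrite (_ : (fun y => _) = (fun y => (\1_(`[X w + g, Y w[%classic) y)%:E)); last first.
    apply/funext => y; congr (_%:E); rewrite !indicE; congr (nat_of_bool _)%:R.
    by apply/idP/idP; rewrite !inE /A /= in_itv /= => /andP.
  rewrite (@integral_indic _ _ _ leb setT measurableT)// setIT.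
  rewrite [RHS](lebesgue_measure_itv `[X w + g, Y w[) /= lte_fin.
  case: ifPn => H'.
    by rewrite -EFinD; congr (_%:E); rewrite opprD addrA; apply/max_idPr; lra.
  by congr (_%:E); apply/max_idPl; lra.
rewrite H; last by move=> z; rewrite lee_fin.
apply: eq_integral => t _; rewrite -layerE.
rewrite -[in RHS](setIT (ysection A t)) -integral_indic//; last first.
  exact: measurable_ysection.
by apply: eq_integral => w _; rewrite !indicE mem_ysection.
Qed.

End hinge_layers.

Lemma le_integral_hinge d1 d2 (T1 : measurableType d1) (T2 : measurableType d2)
    (R : realType) (P1 : probability T1 R) (P2 : probability T2 R)
    (X1 Y1 : T1 -> R) (X2 Y2 : T2 -> R) (g : R) :
  measurable_fun [set: T1] X1 -> measurable_fun [set: T1] Y1 ->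
  measurable_fun [set: T2] X2 -> measurable_fun [set: T2] Y2 ->
  (forall a b, P1 [set w | (X1 w <= a)%R /\ (b < Y1 w)%R] <=
               P2 [set w | (X2 w <= a)%R /\ (b < Y2 w)%R])%E ->
  (\int[P1]_w (Num.max 0 (Y1 w - X1 w - g))%:E <=
   \int[P2]_w (Num.max 0 (Y2 w - X2 w - g))%:E)%E.
Proof.
move=> mX1 mY1 mX2 mY2 XY; rewrite !integral_hinge_layers//.
apply: ge0_le_integral => //.
- exact: measurable_hinge_layer.
- exact: measurable_hinge_layer.
Qed.

Section convex_cost.
Variables (R : realType) (h : R -> R).
Hypothesis h_ge0 : forall x : R, 0 <= h x.
Hypothesis h_convex : @convex_function R R^o [set: R] h.
Hypothesis h0 : h 0 = 0.

(** The cost is a pointwise limit of combinations of hinges, each of them measurable. *)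
Lemma measurable_convex_distance d (T : measurableType d) (X Y : T -> R) :
  measurable_fun [set: T] X -> measurable_fun [set: T] Y ->
  measurable_fun [set: T] (fun w => h `|X w - Y w|).
Proof.
move=> mX mY.
have [N [a [g [a0 g0 _ hcvg]]]] := convex_hinge_approximation h_ge0 h_convex h0.
apply: (@measurable_fun_cvg _ _ _ _ (fun n w =>
  \sum_(k < N n) a n k * Num.max 0 (`|X w - Y w| - g n k))) => [n|w _].
  apply: measurable_sum => k; apply: measurable_funM => //.
  apply: measurable_maxr => //; apply: measurable_funB => //.
  by apply: measurableT_comp => //; exact: measurable_funB.
exact: hcvg.
Qed.

(** The comparison holds hinge by hinge. For [P2], the approximants are bounded by [h]; for [P1],
    they need not increase with [n], so the limit is taken with Fatou's lemma. *)
Lemma le_integral_convex_distance d1 d2 (T1 : measurableType d1)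
    (T2 : measurableType d2) (P1 : probability T1 R) (P2 : probability T2 R)
    (X1 Y1 : T1 -> R) (X2 Y2 : T2 -> R) :
  measurable_fun [set: T1] X1 -> measurable_fun [set: T1] Y1 ->
  measurable_fun [set: T2] X2 -> measurable_fun [set: T2] Y2 ->
  (forall a b, P1 [set w | (X1 w <= a)%R /\ (b < Y1 w)%R] <=
               P2 [set w | (X2 w <= a)%R /\ (b < Y2 w)%R])%E ->
  (forall a b, P1 [set w | (Y1 w <= b)%R /\ (a < X1 w)%R] <=
               P2 [set w | (Y2 w <= b)%R /\ (a < X2 w)%R])%E ->
  (\int[P1]_w (h `|X1 w - Y1 w|)%:E <= \int[P2]_w (h `|X2 w - Y2 w|)%:E)%E.
Proof.
move=> mX1 mY1 mX2 mY2 XY YX.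
have [N [a [g [a0 g0 hle hcvg]]]] := convex_hinge_approximation h_ge0 h_convex h0.
pose f n z := \sum_(k < N n) a n k * Num.max 0 (z - g n k).
have f0 n z : 0 <= f n z.
  by apply: sumr_ge0 => k _; rewrite mulr_ge0// le_max lexx.
have mf d (T : measurableType d) (X Y : T -> R) n :
    measurable_fun [set: T] X -> measurable_fun [set: T] Y ->
    measurable_fun [set: T] (fun w => (f n `|X w - Y w|)%:E).
  move=> mX mY; apply/measurable_EFinP.
  apply: measurable_sum => k; apply: measurable_funM => //.
  apply: measurable_maxr => //; apply: measurable_funB => //.
  by apply: measurableT_comp => //; exact: measurable_funB.
have intf d (T : measurableType d) (P : probability T R) (X Y : T -> R) n :
    measurable_fun [set: T] X -> measurable_fun [set: T] Y ->
    (\int[P]_w (f n `|X w - Y w|)%:E = \sum_(k < N n) (a n k)%:E *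
      (\int[P]_w (Num.max 0 (Y w - X w - g n k))%:E +
       \int[P]_w (Num.max 0 (X w - Y w - g n k))%:E))%E.
  move=> mX mY.
  have mh (U V : T -> R) k : measurable_fun [set: T] U ->
      measurable_fun [set: T] V ->
      measurable_fun [set: T] (fun w => (Num.max 0 (U w - V w - g n k))%:E).
    move=> mU mV; apply/measurable_EFinP; apply: measurable_maxr => //.
    by apply: measurable_funB => //; exact: measurable_funB.
  have h0' (U V : T -> R) k :
      forall w, setT w -> (0 <= (Num.max 0 (U w - V w - g n k))%:E)%E.
    by move=> w _; rewrite lee_fin le_max lexx.
  transitivity (\int[P]_w (\sum_(k < N n) (a n k)%:E *
      ((Num.max 0 (Y w - X w - g n k))%:E + (Num.max 0 (X w - Y w - g n k))%:E)))%E.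
    apply: eq_integral => w _; rewrite /f -sumEFin; apply: eq_bigr => k _.
    by rewrite hinge_distance// EFinM EFinD.
  rewrite ge0_integral_sum//; first last.
  - move=> k w _; apply: mule_ge0; rewrite ?lee_fin//.
    by rewrite addr_ge0// le_max lexx.
  - by move=> k; apply: measurable_funeM; apply: emeasurable_funD; exact: mh.
  apply: eq_bigr => k _; rewrite ge0_integralZl//; first last.
  - by rewrite lee_fin.
  - by move=> w _; apply: adde_ge0; rewrite h0'.
  - by apply: emeasurable_funD; exact: mh.
  by rewrite ge0_integralD//; [exact: h0'|exact: mh|exact: h0'|exact: mh].
set K := (leRHS).
have fK n : (\int[P1]_w (f n `|X1 w - Y1 w|)%:E <= K)%E.
  apply: (@le_trans _ _ (\int[P2]_w (f n `|X2 w - Y2 w|)%:E)%E).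
    rewrite !intf//; apply: lee_sum => k _; apply: lee_wpmul2l; rewrite ?lee_fin//.
    by apply: leeD; apply: le_integral_hinge.
  apply: ge0_le_integral => //.
  - by move=> w _; rewrite lee_fin.
  - exact: mf.
  - by apply/measurable_EFinP; exact: measurable_convex_distance.
  - by move=> w _; rewrite lee_fin; exact: hle.
have -> : (\int[P1]_w (h `|X1 w - Y1 w|)%:E =
   \int[P1]_w limn_einf (fun n => (f n `|X1 w - Y1 w|)%:E))%E.
  apply: eq_integral => w _.
  have hw := hcvg `|X1 w - Y1 w| (normr_ge0 _).
  have {}hw : (f n `|X1 w - Y1 w|)%:E @[n --> \oo] --> (h `|X1 w - Y1 w|)%:E.
    by apply: cvg_EFin hw; exact: nearW.
  rewrite is_cvg_limn_einfE; first by apply/esym/cvg_lim.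
  by apply/cvg_ex; exists (h `|X1 w - Y1 w|)%:E.
apply: le_trans (fatou _ _ _ _) _ => //.
- by move=> n; exact: mf.
- by move=> n w _; rewrite lee_fin.
rewrite limn_einf_lim; apply: lime_le; first exact: is_cvg_einfs.
apply: nearW => n; apply: le_trans (fK n); apply: ereal_inf_lbound.
by exists n => /=.
Qed.

End convex_cost.

(* The hypotheses on [C] say that, conditionally on [Z1], the joint law of
   [X1] and [Y1] is carried by a monotone set. *)
Lemma monotone_rearrangement_optimal (R : realType) (h : R -> R)
    d1 d2 d3 (T1 : measurableType d1) (T2 : measurableType d2)
    (B : measurableType d3) (P1 : probability T1 R) (P2 : probability T2 R)
    (X1 Y1 : T1 -> R) (X2 Y2 : T2 -> R) (Z1 : T1 -> B) (Z2 : T2 -> B) :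
  (forall x, 0 <= h x) -> @convex_function R R^o [set: R] h -> h 0 = 0 ->
  measurable_fun [set: T1] X1 -> measurable_fun [set: T1] Y1 ->
  measurable_fun [set: T1] Z1 ->
  measurable_fun [set: T2] X2 -> measurable_fun [set: T2] Y2 ->
  measurable_fun [set: T2] Z2 ->
  (forall a C, measurable C -> P1 [set w | X1 w <= a /\ C (Z1 w)] =
                               P2 [set w | X2 w <= a /\ C (Z2 w)]) ->
  (forall b C, measurable C -> P1 [set w | Y1 w <= b /\ C (Z1 w)] =
                               P2 [set w | Y2 w <= b /\ C (Z2 w)]) ->
  (forall a b, exists C, [/\ measurable C,
     P1 [set w | [/\ X1 w <= a, b < Y1 w & ~ C (Z1 w)]] = 0%E &
     P1 [set w | [/\ Y1 w <= b, a < X1 w & C (Z1 w)]] = 0%E]) ->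
  (\int[P1]_w (h `|X1 w - Y1 w|)%:E <= \int[P2]_w (h `|X2 w - Y2 w|)%:E)%E.
Proof.
move=> h_ge0 h_convex h0.
(* The two null sets give P1(X <= a, b < Y) = P1(X <= a, C) - P1(Y <= b, C). The right-hand side
   depends only on the laws of (X, Z) and (Y, Z), and for [P2] the same difference is a lower
   bound. *)
have key (X1' Y1' : T1 -> R) (X2' Y2' : T2 -> R) a b C :
    measurable_fun [set: T1] X1' -> measurable_fun [set: T1] Y1' ->
    measurable_fun [set: T1] Z1 ->
    measurable_fun [set: T2] X2' -> measurable_fun [set: T2] Y2' ->
    measurable_fun [set: T2] Z2 -> measurable C ->
    P1 [set w | X1' w <= a /\ C (Z1 w)] = P2 [set w | X2' w <= a /\ C (Z2 w)] ->
    P1 [set w | Y1' w <= b /\ C (Z1 w)] = P2 [set w | Y2' w <= b /\ C (Z2 w)] ->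
    P1 [set w | [/\ X1' w <= a, b < Y1' w & ~ C (Z1 w)]] = 0%E ->
    P1 [set w | [/\ Y1' w <= b, a < X1' w & C (Z1 w)]] = 0%E ->
    (P1 [set w | (X1' w <= a)%R /\ (b < Y1' w)%R] <=
     P2 [set w | (X2' w <= a)%R /\ (b < Y2' w)%R])%E.
  move=> mX1 mY1 mZ1 mX2 mY2 mZ2 mC eX eY n1 n2.
  have mle d (T : measurableType d) (U : T -> R) c : measurable_fun [set: T] U ->
      measurable [set w | U w <= c].
    move=> mU; rewrite -[X in measurable X]setTI.
    by have := mU measurableT `]-oo, c]%classic (measurable_itv _).
  have mgt d (T : measurableType d) (U : T -> R) c : measurable_fun [set: T] U ->
      measurable [set w | c < U w].
    move=> mU; rewrite -[X in measurable X]setTI.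
    have := mU measurableT `]c, +oo[%classic (measurable_itv _).
    by congr measurable; apply/seteqP; split => w /=; rewrite in_itv /= andbT.
  have mpre d (T : measurableType d) (Z : T -> B) : measurable_fun [set: T] Z ->
      measurable [set w | C (Z w)].
    by move=> mZ; rewrite -[X in measurable X]setTI; exact: mZ.
  have split2 d (T : measurableType d) (P : probability T R) (E F : set T) :
      measurable E -> measurable F -> (P E = P (E `&` F) + P (E `&` ~` F))%E.
    by move=> mE mF; rewrite addeC -setDE; exact: measureDI.
  pose D1 := [set w | X1' w <= a /\ C (Z1 w)].
  pose D2 := [set w | X2' w <= a /\ C (Z2 w)].
  have mD1 : measurable D1 by apply: measurableI; [exact: mle|exact: mpre].
  have mD2 : measurable D2 by apply: measurableI; [exact: mle|exact: mpre].
  have := split2 _ _ P1 D1 [set w | Y1' w <= b] mD1 (mle _ _ _ _ mY1).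
  have := split2 _ _ P2 D2 [set w | Y2' w <= b] mD2 (mle _ _ _ _ mY2).
  have -> : (P1 [set w | (X1' w <= a)%R /\ (b < Y1' w)%R] =
      P1 (D1 `&` ~` [set w | (Y1' w <= b)%R]))%E.
    rewrite (split2 _ _ _ _ [set w | C (Z1 w)]); last 2 first.
    - by apply: measurableI; [exact: mle|exact: mgt].
    - exact: mpre.
    rewrite [X in (_ + X)%E](_ : _ = 0%E) ?adde0; last first.
      by rewrite -n1; congr (P1 _); apply/seteqP; split => w /= [] // [].
    congr (P1 _); apply/seteqP; split => w /=.
      by move=> [[? bY] ?]; split => //; apply/negP; rewrite -ltNge.
    by move=> [[? ?] /negP]; rewrite -ltNge.
  have eqY : P1 (D1 `&` [set w | Y1' w <= b]) = P2 [set w | Y2' w <= b /\ C (Z2 w)].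
    rewrite -eY [RHS](split2 _ _ _ _ [set w | X1' w <= a]); last 2 first.
    - by apply: measurableI; [exact: mle|exact: mpre].
    - exact: mle.
    rewrite [X in (_ + X)%E](_ : _ = 0%E) ?adde0; last first.
      rewrite -n2; congr (P1 _); apply/seteqP; split => w /=.
        by move=> [[? ?] /negP]; rewrite -ltNge.
      by move=> [? aX ?]; split => //; apply/negP; rewrite -ltNge.
    by congr (P1 _); apply/seteqP; split => w /= [[]].
  have leY : (P2 (D2 `&` [set w | (Y2' w <= b)%R]) <=
      P2 [set w | (Y2' w <= b)%R /\ C (Z2 w)])%E.
    apply: le_measure; rewrite ?inE.
    - by apply: measurableI => //; exact: mle.
    - by apply: measurableI; [exact: mle|exact: mpre].
    - by move=> w /= [[]].
  rewrite eqY /D1 eX -/D2 => -> eqD.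
  have le2 : (P2 (D2 `&` ~` [set w | (Y2' w <= b)%R]) <=
      P2 [set w | (X2' w <= a)%R /\ (b < Y2' w)%R])%E.
    apply: le_measure; rewrite ?inE.
    - by apply: measurableI => //; apply: measurableC; exact: mle.
    - by apply: measurableI; [exact: mle|exact: mgt].
    - by move=> w /= [[? ?] /negP]; rewrite -ltNge.
  apply: le_trans le2.
  have fin d (T : measurableType d) (P : probability T R) (E : set T) :
    measurable E -> P E \is a fin_num by move=> mE; exact: fin_num_measure.
  have mDY1 : measurable (D1 `&` ~` [set w | Y1' w <= b]).
    by apply: measurableI => //; apply: measurableC; exact: mle.
  have mDY2 : measurable (D2 `&` ~` [set w | Y2' w <= b]).
    by apply: measurableI => //; apply: measurableC; exact: mle.
  have mYC : measurable [set w | Y2' w <= b /\ C (Z2 w)].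
    by apply: measurableI; [exact: mle|exact: mpre].
  by rewrite -(leeD2lE _ _ (fin _ _ P2 _ mYC)) -eqD leeD2r.
move=> mX1 mY1 mZ1 mX2 mY2 mZ2 eX eY mono.
apply: le_integral_convex_distance => // a b.
  by have [C [mC n1 n2]] := mono a b; apply: (key _ _ _ _ _ _ C) => //;
    [exact: eX|exact: eY].
(* Exchanging the roles of X and Y turns the monotonicity hypothesis for [C] into the one for its
   complement. *)
have [C [mC n1 n2]] := mono a b; apply: (key _ _ _ _ _ _ (~` C)) => //.
- exact: measurableC.
- by apply: eY; exact: measurableC.
- by apply: eX; exact: measurableC.
- by rewrite -n2; congr (P1 _); apply/seteqP; split => w /= [? ?]; rewrite ?notK.
Qed.

(** * Distribution functions and the distributional transform *)

Section law_on_line.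
Variables (R : realType) (rho : probability R R).
Implicit Types s t u y : R.
Local Notation F := (law_cdf rho).

Definition law_cdf_left (m : {measure set R -> \bar R}) (t : R) : R :=
  fine (m `]-oo, t[%classic).
Local Notation G := (law_cdf_left rho).

Lemma law_cdfE t : (F t)%:E = rho `]-oo, t]%classic.
Proof. by rewrite /law_cdf fineK// fin_num_measure. Qed.

Lemma law_cdf_leftE t : (G t)%:E = rho `]-oo, t[%classic.
Proof. by rewrite /law_cdf_left fineK// fin_num_measure. Qed.

Lemma law_cdf_ge0 t : 0 <= F t.
Proof. by rewrite -lee_fin law_cdfE. Qed.

Lemma law_cdf_le1 t : F t <= 1.
Proof. by rewrite -lee_fin law_cdfE; exact: probability_le1. Qed.

Lemma law_cdf_left_le t : G t <= F t.
Proof.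
rewrite -lee_fin law_cdfE law_cdf_leftE le_measure ?inE//.
by move=> x /=; rewrite !in_itv /=; exact: ltW.
Qed.

Lemma le_law_cdf s t : s <= t -> F s <= F t.
Proof.
move=> st; rewrite -lee_fin !law_cdfE le_measure ?inE//.
by move=> x /=; rewrite !in_itv /= => /le_trans; exact.
Qed.

Lemma law_cdf_le_left s t : s < t -> F s <= G t.
Proof.
move=> st; rewrite -lee_fin law_cdfE law_cdf_leftE le_measure ?inE//.
by move=> x /=; rewrite !in_itv /= => /le_lt_trans; exact.
Qed.

Lemma le_law_cdf_left s t : s <= t -> G s <= G t.
Proof.
move=> st; rewrite -lee_fin !law_cdf_leftE le_measure ?inE//.
by move=> x /=; rewrite !in_itv /= => /lt_le_trans; exact.
Qed.

Lemma law_atomE t : rho [set t] = (F t - G t)%:E.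
Proof.
rewrite EFinB law_cdfE law_cdf_leftE.
have -> : [set t] = `]-oo, t]%classic `\` `]-oo, t[%classic.
  apply/seteqP; split => x /=; rewrite !in_itv /=.
    by move=> ->; rewrite lexx ltxx.
  by move=> [xt /negP]; rewrite -leNgt => tx; apply/eqP; rewrite eq_le xt.
rewrite measureD//; last by rewrite ltey_eq fin_num_measure.
congr (_ - rho _)%E; apply/seteqP; split => x /=; rewrite !in_itv /=.
  by move=> [].
by move=> xt; split => //; exact: ltW.
Qed.

(** The identity under [rho] is a random variable of law [rho], which transfers the limits and the
    right continuity of [cdf] to [F]. *)
Let X : {RV rho >-> R} := HB.pack (idfun : R -> R)
  (isMeasurableFun.Build _ _ R R idfun (@measurable_id _ R setT)).

Let cdfE t : cdf X t = (F t)%:E.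
Proof. by rewrite law_cdfE /cdf /distribution /pushforward preimage_id. Qed.

Let law_cdf_right_closed s t : (forall t', t < t' -> s <= F t') -> s <= F t.
Proof.
move=> H.
have := @cdf_right_continuous _ _ _ _ X t.
rewrite (_ : cdf _ = (fun t => (F t)%:E)); last by apply/funext => x; rewrite cdfE.
move=> /fine_cvg /= cF.
apply: (cvgr_to_ge cF); near=> x; apply: H.
by near: x; exact: nbhs_right_gt.
Unshelve. all: by end_near. Qed.

Let law_cdf_gt0_dom s : s < 1 -> exists t, s <= F t.
Proof.
move=> s1; have := @cvg_cdfy1 _ _ _ _ X.
rewrite (_ : cdf _ = (fun t => (F t)%:E)); last by apply/funext => x; rewrite cdfE.
move=> /fine_cvg /= /cvgr_gt /(_ _ s1) [M [_ HM]].
by exists (M + 1); apply: ltW; apply: HM; rewrite ltrDl.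
Qed.

Let law_cdf_lt1_dom s : 0 < s -> exists t, F t < s.
Proof.
move=> s0; have := @cvg_cdfNy0 _ _ _ _ X.
rewrite (_ : cdf _ = (fun t => (F t)%:E)); last by apply/funext => x; rewrite cdfE.
move=> /fine_cvg /= /cvgr_lt /(_ _ s0) [M [_ HM]].
by exists (M - 1); apply: HM; rewrite ltrBlDr ltrDl.
Qed.

(** For [0 < s] the set in the infimum is bounded below, for [s < 1] it is nonempty, and right
    continuity of [F] makes the infimum attained. *)
Lemma quantile_le s t : 0 < s -> s < 1 -> (quantile rho s <= t) = (s <= F t).
Proof.
move=> s0 s1; rewrite /quantile; set E := [set _ | _].
have E0 : E !=set0 by exact: law_cdf_gt0_dom.
have [l Fl] := law_cdf_lt1_dom s0.
have lbE : lbound E l.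
  move=> x /= sx; rewrite leNgt; apply/negP => xl.
  by have := le_law_cdf (ltW xl); rewrite leNgt (lt_le_trans Fl sx).
have hE : has_inf E by split => //; exists l.
apply/idP/idP => [Et|st]; last by apply: ge_inf => //; exists l.
apply: law_cdf_right_closed => t' tt'.
have [x Ex xt'] := inf_lt E0 (le_lt_trans Et tt').
by rewrite (le_trans Ex)// le_law_cdf// ltW.
Qed.

(** To the left of the quantile [F] is below [s], and [G] at the quantile is the limit of [F] along
    points increasing to it. *)
Lemma law_cdf_left_quantile s : 0 < s -> s < 1 -> G (quantile rho s) <= s.
Proof.
move=> s0 s1; set q := quantile rho s.
have Fs t : t < q -> F t < s by rewrite !ltNge quantile_le.
have qE : `]-oo, q[%classic = \bigcup_n `]-oo, q - n.+1%:R^-1]%classic.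
  apply/seteqP; split => x /=; rewrite in_itv /=.
    rewrite -subr_gt0 => /ltr_add_invr[n]; rewrite add0r => nx.
    by exists n => //=; rewrite in_itv /= lerBrDr -lerBrDl ltW.
  move=> [n _] /=; rewrite in_itv /= => /le_lt_trans; apply.
  by rewrite ltrBlDr ltrDl invr_gt0.
rewrite -lee_fin law_cdf_leftE qE.
have nd : nondecreasing_seq (fun n => `]-oo, q - n.+1%:R^-1]%classic).
  move=> m n mn; apply/subsetPset => x /=; rewrite !in_itv /= => /le_trans; apply.
  by rewrite lerD2l lerN2 lef_pV2 ?posrE// ler_nat.
have := @nondecreasing_cvg_mu _ _ _ rho _ (fun n => measurable_itv _)
  (bigcup_measurable (fun n _ => measurable_itv _)) nd.
move=> cv; rewrite -(cvg_lim _ cv)//; apply: lime_le.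
  by apply/cvg_ex; eexists; exact: cv.
apply: nearW => n /=; rewrite -law_cdfE lee_fin; apply: ltW; apply: Fs.
by rewrite ltrBlDr ltrDl invr_gt0.
Qed.

End law_on_line.

(** * The uniform law on the unit interval *)

Section uniform_measure.
Variable R : realType.

(* [uniform_prob] lives on the carrier of [R] equipped with a display other than
   the one used by [probability R R]. *)
Definition uniform01 : set R -> \bar R := uniform_prob (@ltr01 R).

HB.instance Definition _ := isMeasure.Build _ R R uniform01
  (measure0 (uniform_prob (@ltr01 R))) (measure_ge0 (uniform_prob (@ltr01 R)))
  (@measure_semi_sigma_additive _ _ _ (uniform_prob (@ltr01 R))).

HB.instance Definition _ := Measure_isProbability.Build _ R R uniform01
  (@probability_setT _ _ _ (uniform_prob (@ltr01 R))).

Lemma uniform01E (A : set R) : measurable A ->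
  uniform01 A = lebesgue_measure (A `&` `[0, 1]%classic).
Proof.
move=> mA.
have m1 : measurable_fun [set: R] (fun x => (\1_A x : R)%:E).
  by apply/measurable_EFinP; exact: measurable_indic.
have := @integral_uniform R 0 1 (@ltr01 R) _ m1 (fun x => _).
rewrite integral_indic// setIT => -> ; last by move=> x; rewrite lee_fin.
by rewrite subr0 invr1 mul1e integral_indic.
Qed.

End uniform_measure.

(* Distributional transform: if [y] has law [m] and [u] is uniform on [0, 1]
   and independent of [y], then [dtransform m y u] is uniform on [0, 1]. *)
Definition dtransform (R : realType) (m : {measure set R -> \bar R}) (y u : R) : R :=
  law_cdf_left m y + u * (law_cdf m y - law_cdf_left m y).

Section distributional_transform.
Variables (R : realType) (rho : probability R R).
Implicit Types s t u y : R.
Local Notation F := (law_cdf rho).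
Local Notation G := (law_cdf_left rho).
Local Notation S := (dtransform rho).
Local Notation U := (@uniform01 R).

Lemma dtransform_le y u : u <= 1 -> S y u <= F y.
Proof.
by move=> u1; have := law_cdf_left_le rho y; rewrite /dtransform; nra.
Qed.

Lemma dtransform_ge y u : 0 <= u -> G y <= S y u.
Proof.
by move=> u0; have := law_cdf_left_le rho y; rewrite /dtransform; nra.
Qed.

Lemma measurable_law_cdf : measurable_fun [set: R] F.
Proof. by apply: nondecreasing_measurable => // x y; exact: le_law_cdf. Qed.

Lemma measurable_law_cdf_left : measurable_fun [set: R] G.
Proof. by apply: nondecreasing_measurable => // x y; exact: le_law_cdf_left. Qed.

Lemma measurable_dtransform1 :
  measurable_fun [set: R * R] (fun z => S z.1 z.2).
Proof.
have mF : measurable_fun [set: R * R] (fun z => F z.1).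
  by apply: measurableT_comp => //; exact: measurable_law_cdf.
have mG : measurable_fun [set: R * R] (fun z => G z.1).
  by apply: measurableT_comp => //; exact: measurable_law_cdf_left.
apply: measurable_funD => //; apply: measurable_funM => //.
exact: measurable_funB.
Qed.

Let U_dtransform_lt s y : U [set u | S y u < s] =
  lebesgue_measure ([set u | S y u < s] `&` `[0, 1]%classic).
Proof.
apply: uniform01E; rewrite -[X in measurable X]setTI.
have : measurable_fun [set: R] (S y).
  apply: measurable_funD => //; apply: measurable_funM => //.
by move=> /(_ measurableT `]-oo, s[%classic (measurable_itv _)).
Qed.

(** Let [q] be the quantile at [s]. Points [y < q] contribute fully, since [F y < s]; points [y > q]
    contribute nothing, since [s <= G y]; at [y = q] a fraction [v] of the values of [u]
    contributes. The total is [G q + v * (F q - G q) = s]. *)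
Lemma dtransform_lt_uniform s : 0 < s -> s < 1 ->
  (\int[rho]_y U [set u | (S y u < s)%R] = s%:E)%E.
Proof.
move=> s0 s1; set q := quantile rho s.
have Gq : G q <= s := law_cdf_left_quantile rho s0 s1.
have Fq : s <= F q by rewrite -quantile_le.
have below y : y < q -> U [set u | S y u < s] = 1%E.
  move=> yq; have Fy : F y < s by rewrite ltNge -quantile_le// -ltNge.
  rewrite U_dtransform_lt (_ : _ `&` _ = `[0, 1]%classic).
    by rewrite [LHS](lebesgue_measure_itv `[0, 1]) /= lte01 sube0.
  apply/setIidr => u /=; rewrite in_itv /= => /andP[_ u1].
  exact: le_lt_trans (dtransform_le y u1) Fy.
have above y : q < y -> U [set u | S y u < s] = 0%E.
  move=> qy; rewrite U_dtransform_lt (_ : _ `&` _ = set0) ?measure0//.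
  apply/seteqP; split => // u /= [Ss]; rewrite in_itv /= => /andP[u0 _].
  have := law_cdf_le_left rho qy; have := dtransform_ge y u0; lra.
have [v vE vj] : exists2 v, U [set u | S q u < s] = v%:E &
    v * (F q - G q) = s - G q.
  have mS : measurable [set u | S q u < s].
    rewrite -[X in measurable X]setTI.
    have : measurable_fun [set: R] (S q).
      by apply: measurable_funD => //; exact: measurable_funM.
    by move=> /(_ measurableT `]-oo, s[%classic (measurable_itv _)).
  (* Without an atom at [q] any [v] will do: its weight is zero, and [G q = s]. *)
  have [j0|j0] := eqVneq (F q - G q) 0.
    exists (fine (U [set u | S q u < s])); first by rewrite fineK// fin_num_measure.
    by rewrite j0 mulr0; lra.
  have jp : 0 < F q - G q by rewrite lt_neqAle eq_sym j0 subr_ge0 law_cdf_left_le.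
  exists ((s - G q) / (F q - G q)); last by rewrite divfK.
  rewrite U_dtransform_lt.
  have -> : [set u | S q u < s] `&` `[0, 1]%classic =
      `[0, (s - G q) / (F q - G q)[%classic :> set R.
    apply/seteqP; split => u /=; rewrite !in_itv /= /dtransform.
      move=> [H /andP[u0 u1]].
      by rewrite u0/= ltr_pdivlMr//; lra.
    move=> /andP[u0]; rewrite ltr_pdivlMr// => H; split; first lra.
    rewrite u0 /=; nra.
  rewrite [LHS](lebesgue_measure_itv `[0, (s - G q) / (F q - G q)[) /= lte_fin.
  case: ltP => [_|]; first by rewrite sube0.
  move=> H; congr (_%:E); apply/esym/eqP; rewrite eq_le H /= divr_ge0//; lra.
have v0 : 0 <= v by rewrite -lee_fin -vE.
transitivity (\int[rho]_y ((\1_(`]-oo, q[%classic) y)%:E +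
    v%:E * (\1_[set q] y)%:E))%E.
  apply: eq_integral => y _; rewrite !indicE.
  have [yq|qy|->] := ltgtP y q.
  - rewrite below// mem_set ?in_itv//= memNset ?mule0 ?adde0//.
    by move=> /= yqE; rewrite yqE ltxx in yq.
  - rewrite above// memNset/=; last by rewrite in_itv/= ltNge ltW.
    rewrite memNset ?mule0 ?adde0//.
    by move=> /= yqE; rewrite yqE ltxx in qy.
  - by rewrite vE memNset/= ?in_itv/= ?ltxx// mem_set// mule1 add0e.
rewrite ge0_integralD//; last first.
- apply: measurable_funeM; apply/measurable_EFinP; exact: measurable_indic.
- by move=> y _; rewrite mule_ge0// lee_fin.
- apply/measurable_EFinP; exact: measurable_indic.
rewrite ge0_integralZl//; last first.
- by apply/measurable_EFinP; exact: measurable_indic.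
have -> : (\int[rho]_x (\1_(`]-oo, q[%classic) x)%:E = (G q)%:E)%E.
  by rewrite law_cdf_leftE integral_indic// setIT.
have -> : (\int[rho]_x (\1_[set q] x)%:E = (F q - G q)%:E)%E.
  by rewrite -law_atomE integral_indic// setIT.
rewrite -EFinM -EFinD vj.
by congr (_%:E); lra.
Qed.

(** The open version is applied on both sides: the event lies in [S < t] for [t] slightly above [s],
    and together with [S < a] for small [a] it covers [S < t] for [t] slightly below [s]. *)
Lemma dtransform_uniform s : 0 <= s -> s <= 1 ->
  (\int[rho]_y U [set u | [/\ 0 < S y u, S y u < 1 & S y u <= s]%R] = s%:E)%E.
Proof.
move=> s0 s1.
have mS : measurable_fun [set: R * R] (fun z => S z.1 z.2) := measurable_dtransform1.
have mlt t : measurable [set z : R * R | S z.1 z.2 < t].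
  rewrite -[X in measurable X]setTI.
  exact: (mS measurableT `]-oo, t[%classic (measurable_itv _)).
have mle t : measurable [set z : R * R | S z.1 z.2 <= t].
  rewrite -[X in measurable X]setTI.
  exact: (mS measurableT `]-oo, t]%classic (measurable_itv _)).
have mgt t : measurable [set z : R * R | t < S z.1 z.2].
  rewrite (_ : [set z | _] = ~` [set z : R * R | S z.1 z.2 <= t]).
    exact: measurableC.
  by apply/seteqP; split => z /=; rewrite ltNge => /negP.
pose Q := (rho \x U)%E.
pose E := [set z : R * R | [/\ 0 < S z.1 z.2, S z.1 z.2 < 1 & S z.1 z.2 <= s]].
have mE : measurable E.
  rewrite (_ : E = [set z | 0 < S z.1 z.2] `&` ([set z | S z.1 z.2 < 1] `&`
      [set z | S z.1 z.2 <= s])); last first.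
    by apply/seteqP; split => z /=; [move=> []|move=> [? []]].
  by apply: measurableI => //; exact: measurableI.
have xsE (A : set (R * R)) y : xsection A y = [set u | A (y, u)].
  by apply/seteqP; split => u; rewrite /xsection /= inE.
have -> : (\int[rho]_y U [set u | [/\ 0 < S y u, S y u < 1 & S y u <= s]%R] = Q E)%E.
  by apply: eq_integral => y _; rewrite /= xsE.
have Qlt t : 0 < t -> t < 1 -> Q [set z | S z.1 z.2 < t] = t%:E.
  move=> t0 t1; rewrite -(dtransform_lt_uniform t0 t1).
  by apply: eq_integral => y _; rewrite /= xsE.
have QE1 : (Q E <= 1)%E by exact: probability_le1.
apply/eqP; rewrite eq_le; apply/andP; split.
  have [s1'|s1'] := ltP s 1; last by have -> : s = 1 by lra.
  apply/lee_addgt0Pr => e e0.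
  have [t [t0 t1 st te]] : exists t, [/\ 0 < t, t < 1, s < t & t <= s + e].
    exists (Num.min (s + e) ((s + 1) / 2)).
    by split; rewrite ?lt_min ?gt_min ?ge_min; lra.
  apply: (@le_trans _ _ t%:E); last by rewrite -EFinD lee_fin.
  rewrite -(Qlt _ t0 t1) le_measure ?inE//.
  by move=> z [_ _ Ss] /=; exact: le_lt_trans Ss st.
have [->|s0'] := eqVneq s 0; first exact: measure_ge0.
apply/lee_addgt0Pr => e e0.
(* The two errors [s - t] and [a] are at most [e / 2] each; the caps [s / 2] and [s / 4] keep [t]
   positive and [a] below 1. *)
pose t := s - Num.min (e / 2) (s / 2).
pose a := Num.min (e / 2) (s / 4).
have sp : 0 < s by lra.
have m0 : 0 < Num.min (e / 2) (s / 2) by rewrite lt_min; apply/andP; split; lra.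
have a0 : 0 < a by rewrite lt_min; apply/andP; split; lra.
have me : Num.min (e / 2) (s / 2) <= e / 2 by rewrite ge_min lexx.
have ms : Num.min (e / 2) (s / 2) <= s / 2 by rewrite ge_min lexx orbT.
have ae : a <= e / 2 by rewrite ge_min lexx.
have as4 : a <= s / 4 by rewrite ge_min lexx orbT.
have t0 : 0 < t by rewrite /t; lra.
have t1 : t < 1 by rewrite /t; lra.
have : (t%:E <= Q E + a%:E)%E.
  rewrite -(Qlt _ t0 t1) -(Qlt _ a0); last by lra.
  apply: le_trans (@measureU2 _ _ _ Q E _ mE (mlt a)).
  rewrite le_measure ?inE//; first exact: measurableU.
  move=> z /= zt; have [za|az] := ltP (S z.1 z.2) a; [by right|left].
  by split; rewrite /t in zt; lra.
move=> tQ; apply: (@le_trans _ _ (t%:E + (Num.min (e / 2) (s / 2))%:E)%E).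
  by rewrite -EFinD lee_fin /t subrK.
apply: (@le_trans _ _ (Q E + a%:E + (Num.min (e / 2) (s / 2))%:E)%E).
  by rewrite leeD2r.
by rewrite -addeA leeD2l// -EFinD lee_fin; lra.
Qed.

End distributional_transform.

(** * Laws and disintegrations *)

Lemma measure_prod_unique d1 d2 (T1 : measurableType d1) (T2 : measurableType d2)
    (R : realType) (m1 m2 : {measure set (T1 * T2) -> \bar R}) :
  (m1 setT < +oo)%E ->
  (forall A B, measurable A -> measurable B -> m1 (A `*` B) = m2 (A `*` B)) ->
  forall E, measurable E -> m1 E = m2 E.
Proof.
move=> m1oo m12 E mE.
apply: (measure_unique [set A `*` B | A in measurable & B in measurable]
  (fun=> setT)) => //.
- exact: measurable_prod_measurableType.
- move=> _ _ [A1 mA1 [B1 mB1 <-]] [A2 mA2 [B2 mB2 <-]].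
  exists (A1 `&` A2); first exact: measurableI.
  by exists (B1 `&` B2); [exact: measurableI|rewrite setXI].
- by move=> _; exists setT => //; exists setT => //; rewrite setXTT.
- by rewrite bigcup_const.
- by move=> _ [A mA [B mB <-]]; exact: m12.
Qed.

Lemma measure_line_unique (R : realType) (m1 m2 : {measure set R -> \bar R}) :
  (m1 setT < +oo)%E ->
  (forall a, m1 `]-oo, a]%classic = m2 `]-oo, a]%classic) ->
  forall A, measurable A -> m1 A = m2 A.
Proof.
move=> m1oo m12 A mA.
pose G := [set A : set R | exists a, A = `]-oo, a]%classic].
apply: (measure_unique G (fun n => `]-oo, n%:R]%classic)) => //.
- rewrite eqEsubset; split.
    have -> : @measurable _ R = <<s @RGenOInfty.G R >> := RGenOInfty.measurableE R.
    apply: smallest_sub; first exact: smallest_sigma_algebra.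
    move=> _ [a ->]; rewrite -setCitvl.
    by apply: sigma_algebraC; apply: sub_sigma_algebra; exists a.
  apply: smallest_sub; first exact: sigma_algebra_measurable.
  by move=> _ [a ->]; exact: measurable_itv.
- move=> _ _ [a ->] [b ->]; exists (Num.min a b).
  apply/seteqP; split => x /=; rewrite !in_itv /= le_min.
    by move=> [-> ->].
  by move=> /andP.
- by move=> n; exists n%:R.
- apply/seteqP; split => // x _.
  exists (Num.truncn `|x|).+1 => //=; rewrite in_itv /=.
  by rewrite (le_trans (ler_norm _))// ltW// truncnS_gt.
- by move=> _ [a ->].
- by move=> n; apply: le_lt_trans m1oo; rewrite le_measure ?inE.
Qed.

Section images.
Context d1 d2 (T1 : measurableType d1) (T2 : measurableType d2) (R : realType).

Definition image_law (P : probability T1 R) (f : T1 -> T2)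
    (mf : measurable_fun [set: T1] f) : probability T2 R :=
  distribution P (HB.pack f (isMeasurableFun.Build _ _ _ _ f mf) : {mfun T1 >-> T2}).

(** A copy of the fibre [k x] carrying the structure of a probability, so that results on a single
    law apply to it. *)
Definition kernel_law (k : R.-pker T1 ~> T2) (x : T1) : set T2 -> \bar R := k x.

HB.instance Definition _ k x := isMeasure.Build _ _ _ (kernel_law k x)
  (measure0 (k x)) (measure_ge0 (k x)) (@measure_semi_sigma_additive _ _ _ (k x)).

HB.instance Definition _ k x := Measure_isProbability.Build _ _ _ (kernel_law k x)
  (prob_kernel x).

Lemma integral_image_law P f mf (g : T2 -> \bar R) :
  measurable_fun [set: T2] g -> (forall y, 0 <= g y)%E ->
  (\int[@image_law P f mf]_y g y = \int[P]_x g (f x))%E.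
Proof. by move=> mg g0; rewrite ge0_integral_distribution. Qed.

Lemma integral_kernel_law k x D g :
  (\int[kernel_law k x]_(y in D) g y = \int[k x]_(y in D) g y)%E.
Proof. by []. Qed.

End images.

(* Joint law of [(b, y)] when [y] has law [k b]. *)
Section graph_kernel.
Context d1 d2 (B : measurableType d1) (F : measurableType d2) (R : realType).
Variable k : R.-pker B ~> F.

Definition graph_kernel (z : unit * B) : {measure set (B * F) -> \bar R} :=
  @image_law _ _ _ _ R (kernel_law k z.2 : probability F R) (pair z.2)
    (@measurable_pair1 _ _ B F z.2).

Lemma graph_kernelE z A : graph_kernel z A = k z.2 (xsection A z.2).
Proof.
transitivity (k z.2 (pair z.2 @^-1` A)) => //; congr (k _ _).
by apply/seteqP; split => y; rewrite /xsection /= inE.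
Qed.

Let measurable_graph_kernel A : measurable A ->
  measurable_fun [set: unit * B] (graph_kernel ^~ A).
Proof.
move=> mA; under eq_fun do rewrite graph_kernelE.
apply: (@measurableT_comp _ _ _ _ _ _ (fun b => k b (xsection A b)) _ snd) => //.
by apply: measurable_fun_xsection_finite_kernel; rewrite inE.
Qed.

HB.instance Definition _ :=
  @isKernel.Build _ _ _ _ R graph_kernel measurable_graph_kernel.

Let graph_kernel_prob z : graph_kernel z [set: B * F] = 1%E.
Proof. by rewrite /graph_kernel; exact: probability_setT. Qed.

HB.instance Definition _ :=
  @Kernel_isProbability.Build _ _ _ _ R graph_kernel graph_kernel_prob.

End graph_kernel.

Section disintegration.
Context d d1 d2 (T : measurableType d) (B : measurableType d1)
  (F : measurableType d2) (R : realType).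
Variables (m : probability T R) (p : T -> B) (q : T -> F) (k : R.-pker B ~> F).
Hypotheses (mp : measurable_fun [set: T] p) (mq : measurable_fun [set: T] q).
Hypothesis mk : is_disintegration m p q k.

(** The disintegration identity is the equality of two joint laws on rectangles; these determine a
    finite measure on the product. *)
Lemma integral_disintegration (f : B * F -> \bar R) :
  measurable_fun [set: B * F] f -> (forall z, 0 <= f z)%E ->
  (\int[m]_w f (p w, q w) =
   \int[pushforward m p]_b \int[k b]_y f (b, y))%E.
Proof.
move=> mf f0.
have mpq : measurable_fun [set: T] (fun w => (p w, q w)).
  exact: measurable_fun_pair.
pose beta := image_law m mp.
(* The law of [p] becomes a kernel from the one-point space, so that the law rebuilt from [k] is a
   composition of kernels; hence the factor [unit] in [graph_kernel]. *)
pose l := kprobability (@measurable_cst _ _ unit _ setT (beta : pprobability B R)).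
rewrite -(@integral_image_law _ _ _ _ _ m _ mpq f)//.
rewrite (eq_measure_integral (kcomp l (graph_kernel k) tt)); last first.
  move=> A mA _; apply: measure_prod_unique mA => [|C D mC mD].
    by apply: le_lt_trans (ltry 1); exact: probability_le1.
  transitivity (m (p @^-1` C `&` q @^-1` D)) => //.
  rewrite mk// /kcomp [LHS]integral_mkcond; apply: eq_integral => b _.
  rewrite graph_kernelE patchE /=; case: ifPn => bC; first by rewrite in_xsectionX.
  by rewrite notin_xsectionX// measure0.
rewrite (@integral_kcomp _ _ _ _ _ _ R l (graph_kernel k) tt f f0 mf).
apply: eq_integral => b _.
by rewrite /graph_kernel /= integral_image_law.
Qed.

End disintegration.

(** * Conditional quantiles *)

Lemma measurable_set_pred d (T : measurableType d) (f : T -> bool) :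
  measurable_fun [set: T] f -> measurable [set x | f x].
Proof.
by move=> mf; rewrite -[X in measurable X]setTI; exact: (mf measurableT [set true]).
Qed.

Section quantile_map.
Context d (B : measurableType d) (R : realType).
Implicit Type k : R.-pker B ~> R.

(* The cut-off removes the junk values of [quantile] outside [0, 1]. *)
Definition quantile_map k (b : B) (s : R) : R :=
  if (0 < s) && (s < 1) then quantile (k b) s else 0.

Lemma quantile_map_le k b s a : 0 < s -> s < 1 ->
  (quantile_map k b s <= a) = (s <= law_cdf (k b) a).
Proof.
move=> s0 s1; rewrite /quantile_map s0 s1 /=.
exact: (@quantile_le R (kernel_law k b)).
Qed.

Lemma measurable_kernel_cdf k a : measurable_fun [set: B] (fun b => law_cdf (k b) a).
Proof.
apply/measurable_EFinP.
rewrite (_ : EFin \o _ = fun b => k b `]-oo, a]%classic); last first.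
  by apply/funext => b; rewrite /= (law_cdfE (kernel_law k b)).
exact: measurable_kernel.
Qed.

(** For [0 < s < 1] the condition [quantile_map k b s <= a] reads [s <= law_cdf (k b) a], where [a]
    is fixed and the right-hand side is measurable in [b]. *)
Lemma measurable_quantile_map k :
  measurable_fun [set: B * R] (fun z => quantile_map k z.1 z.2).
Proof.
have m01 : measurable_fun [set: B * R] (fun z => (0 < z.2) && (z.2 < 1)).
  by apply: measurable_and; apply: measurable_fun_ltr.
apply: (measurability _ (RGenOInfty.measurableE R)) => _ /= -[_ [a ->] <-].
rewrite setTI (_ : _ @^-1` _ =
  ~` ([set z | [&& 0 < z.2, z.2 < 1 & z.2 <= law_cdf (k z.1) a]] `|`
      [set z | ~~ ((0 < z.2) && (z.2 < 1)) && (0 <= a)])).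
  apply: measurableC; apply: measurableU.
    rewrite -[X in measurable X]setTI.
    have : measurable_fun [set: B * R]
        (fun z => [&& 0 < z.2, z.2 < 1 & z.2 <= law_cdf (k z.1) a]).
      under eq_fun do rewrite andbA.
      apply: measurable_and => //; apply: measurable_fun_ler => //.
      apply: (@measurableT_comp _ _ _ _ _ _ (fun b => law_cdf (k b) a) _ fst) => //.
      exact: measurable_kernel_cdf.
    by move=> /(_ measurableT [set true] _); apply.
  rewrite -[X in measurable X]setTI.
  have : measurable_fun [set: B * R]
      (fun z => ~~ ((0 < z.2) && (z.2 < 1)) && (0 <= a)).
    by apply: measurable_and => //; exact: measurable_neg.
  by move=> /(_ measurableT [set true] _); apply.
apply/seteqP; split => z /=; rewrite in_itv /= andbT.
  move=> az [/and3P[z0 z1]|/andP[z01 a0]].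
    by rewrite -quantile_map_le// leNgt az.
  by move: az; rewrite /quantile_map (negbTE z01) ltNge a0.
move=> /not_orP[n1 n2]; rewrite ltNge; apply/negP => za.
have [/andP[z0 z1]|z01] := boolP ((0 < z.2) && (z.2 < 1)).
  by apply: n1; rewrite z0 z1 -quantile_map_le.
by apply: n2; rewrite z01; move: za; rewrite /quantile_map (negbTE z01).
Qed.

End quantile_map.

(** * Variables that are uniform conditionally on another one *)

Section conditionally_uniform.
Context d d' (T : measurableType d) (B : measurableType d') (R : realType).
Variable P : probability T R.

(** The threshold may depend on the conditioning variable, so that a conditional distribution
    function can be substituted for it. The event avoids the end points, where [quantile_map] is cut
    off. *)
Definition uniform_given (Z : T -> B) (S : T -> R) : Prop :=
  forall (C : set B) (s : B -> R), measurable C -> measurable_fun [set: B] s ->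
    (forall b, 0 <= s b <= 1) ->
    P [set w | [/\ C (Z w), 0 < S w, S w < 1 & S w <= s (Z w)]] =
    (\int[pushforward P Z]_(b in C) (s b)%:E)%E.

Variables (Z : T -> B) (S : T -> R).
Hypotheses (mZ : measurable_fun [set: T] Z) (mS : measurable_fun [set: T] S).
Hypothesis SZ : uniform_given Z S.

Let measurable_in01 : measurable [set w | 0 < S w /\ S w < 1].
Proof.
rewrite -[X in measurable X]setTI.
have := mS measurableT (measurable_itv `]0, 1[).
by congr measurable; apply/seteqP; split => w /=; rewrite in_itv /= => -[? /andP].
Qed.

Lemma uniform_given_negligible : P [set w | ~ (0 < S w /\ S w < 1)] = 0%E.
Proof.
have := probability_setC P measurable_in01.
have -> : P [set w | 0 < S w /\ S w < 1] = 1%E; last first.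
  by rewrite subee.
have c01 (b : B) : 0 <= (cst 1 b : R) <= 1 by rewrite ler01 lexx.
have := @SZ setT (cst 1) measurableT (measurable_cst _) c01.
rewrite [X in _ = X -> _](_ : _ = 1%E).
  move=> <-; congr (P _); apply/seteqP; split => w /= [] // *.
  by split => //; exact: ltW.
have := @integral_cst _ _ _ (image_law P mZ) setT measurableT 1%E.
move=> H; apply: etrans H _; rewrite mul1e.
exact: (@probability_setT _ _ _ (image_law P mZ)).
Qed.

Lemma uniform_given_negligibleS (A : set T) : measurable A ->
  A `<=` [set w | ~ (0 < S w /\ S w < 1)] -> P A = 0%E.
Proof.
move=> mA AS; apply: (subset_measure0 mA _ AS uniform_given_negligible).
exact: measurableC.
Qed.

Variable k : R.-pker B ~> R.

Lemma measurable_quantile_map_given :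
  measurable_fun [set: T] (fun w => quantile_map k (Z w) (S w)).
Proof.
apply: (@measurableT_comp _ _ _ _ _ _ (fun z => quantile_map k z.1 z.2) _
  (fun w => (Z w, S w))); first exact: measurable_quantile_map.
exact: measurable_fun_pair.
Qed.

(** Up to a null set [0 < S < 1], and there the event reads [S <= law_cdf (k (Z w)) a], to which
    [uniform_given] applies. *)
Lemma quantile_map_law a C : measurable C ->
  P [set w | quantile_map k (Z w) (S w) <= a /\ C (Z w)] =
  (\int[pushforward P Z]_(b in C) k b `]-oo, a]%classic)%E.
Proof.
move=> mC.
have mq := measurable_quantile_map_given.
have mE : measurable [set w | quantile_map k (Z w) (S w) <= a /\ C (Z w)].
  apply: measurableI.
    rewrite -[X in measurable X]setTI.
    exact: (mq measurableT _ (measurable_itv `]-oo, a])).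
  by rewrite -[X in measurable X]setTI; exact: mZ.
transitivity (P [set w | [/\ C (Z w), 0 < S w, S w < 1 &
    S w <= law_cdf (k (Z w)) a]]); last first.
  rewrite (@SZ C (fun b => law_cdf (k b) a))//.
  - apply: (@eq_integral _ _ _ (image_law P mZ)) => b _.
    by rewrite (law_cdfE (kernel_law k b)).
  - exact: measurable_kernel_cdf.
  move=> b; rewrite (law_cdf_ge0 (kernel_law k b)).
  exact: (law_cdf_le1 (kernel_law k b)).
rewrite (measureDI _ mE measurable_in01).
rewrite [X in (X + _)%E](_ : _ = 0%E) ?add0e.
  congr (P _); apply/seteqP; split => w /=.
    by move=> [[+ ?] [? ?]]; rewrite quantile_map_le.
  by move=> [? ? ? ?]; split => //; split => //; rewrite quantile_map_le.
by apply: uniform_given_negligibleS => [|w []]; first exact: measurableD.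
Qed.

End conditionally_uniform.

Lemma measurable_le_gt_preimage d d' (T : measurableType d) (B : measurableType d')
    (R : realType) (X Y : T -> R) (Z : T -> B) (C : set B) (a b : R) :
  measurable_fun [set: T] X -> measurable_fun [set: T] Y ->
  measurable_fun [set: T] Z -> measurable C ->
  measurable [set w | [/\ X w <= a, b < Y w & C (Z w)]].
Proof.
move=> mX mY mZ mC.
rewrite (_ : mkset _ = (X @^-1` `]-oo, a] `&` Y @^-1` `]b, +oo[) `&` Z @^-1` C).
  by apply: measurableI; [apply: measurableI|]; rewrite -[X in measurable X]setTI;
    [exact: mX|exact: mY|exact: mZ].
apply/seteqP; split => w /=; rewrite !in_itv /= andbT; first by move=> [].
by move=> [[]].
Qed.

Section monotone_couplings.
Context d d' (T : measurableType d) (B : measurableType d') (R : realType).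
Variables (P : probability T R) (Z : T -> B) (S : T -> R).
Hypotheses (mZ : measurable_fun [set: T] Z) (mS : measurable_fun [set: T] S).
Hypothesis SZ : uniform_given P Z S.
Variables k k' : R.-pker B ~> R.

Let measurable_cdf_le a b :
  measurable [set z | law_cdf (k' z) b <= law_cdf (k z) a].
Proof.
rewrite -[X in measurable X]setTI.
have : measurable_fun [set: B] (fun z => law_cdf (k' z) b <= law_cdf (k z) a).
  by apply: measurable_fun_ler; exact: measurable_kernel_cdf.
by move=> /(_ measurableT [set true] _); apply.
Qed.

(** Given [Z], both variables are driven by the same [S]: the events [<= a] and [<= b] read
    [S <= F(a)] and [S <= F'(b)], with [F] and [F'] the distribution functions of [k] and [k']. The
    set [C] records which of these nested events is the larger. *)
Lemma quantile_map_pair_monotone a b : exists C, [/\ measurable C,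
  P [set w | [/\ quantile_map k (Z w) (S w) <= a,
     b < quantile_map k' (Z w) (S w) & ~ C (Z w)]] = 0%E &
  P [set w | [/\ quantile_map k' (Z w) (S w) <= b,
     a < quantile_map k (Z w) (S w) & C (Z w)]] = 0%E].
Proof.
have mk := measurable_quantile_map_given mZ mS k.
have mk' := measurable_quantile_map_given mZ mS k'.
have mC := measurable_cdf_le a b.
exists [set z | law_cdf (k' z) b <= law_cdf (k z) a]; split => //.
- apply: (uniform_given_negligibleS mZ mS SZ).
    exact: measurable_le_gt_preimage (measurableC mC).
  move=> w [qa qb /= /negP]; rewrite -ltNge => ab [S0 S1].
  move: qa qb; rewrite quantile_map_le// ltNge quantile_map_le// => Sa.
  by rewrite (le_trans Sa (ltW ab)).
- apply: (uniform_given_negligibleS mZ mS SZ).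
    exact: measurable_le_gt_preimage mC.
  move=> w [qb qa /= ab] [S0 S1].
  move: qa qb; rewrite ltNge !quantile_map_le// => /negP Sa Sb.
  by apply: Sa; exact: le_trans Sb ab.
Qed.

Variables (W V : T -> R).
Hypotheses (mW : measurable_fun [set: T] W) (mV : measurable_fun [set: T] V).
Hypothesis V01 : P [set w | ~ (0 <= V w <= 1)] = 0%E.
Hypothesis SE : forall w, S w = dtransform (k' (Z w)) (W w) (V w).

(** The same [C] works with [W] in place of its quantile: [W <= b] forces [S <= F'(b)], while
    [b < W] forces [F'(b) <= F'(W-) <= S]. There is thus no need to recover [W] from [S]. *)
Lemma quantile_map_dtransform_monotone a b : exists C, [/\ measurable C,
  P [set w | [/\ quantile_map k (Z w) (S w) <= a, b < W w & ~ C (Z w)]] = 0%E &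
  P [set w | [/\ W w <= b, a < quantile_map k (Z w) (S w) & C (Z w)]] = 0%E].
Proof.
have mk := measurable_quantile_map_given mZ mS k.
have mC := measurable_cdf_le a b.
have null A : measurable A ->
    A `<=` [set w | ~ (0 < S w /\ S w < 1)] `|` [set w | ~ (0 <= V w <= 1)] ->
    P A = 0%E.
  move=> mA AN.
  have mSN : measurable [set w | ~ (0 < S w /\ S w < 1)].
    apply: measurableC; rewrite -[X in measurable X]setTI.
    have := mS measurableT (measurable_itv `]0, 1[).
    by congr measurable; apply/seteqP; split => w /=; rewrite in_itv /= => -[? /andP].
  have mVN : measurable [set w | ~ (0 <= V w <= 1)].
    apply: measurableC; rewrite -[X in measurable X]setTI.
    exact: (mV measurableT (measurable_itv `[0, 1])).
  apply: (subset_measure0 mA _ AN); first exact: measurableU.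
  transitivity (P [set w | ~ (0 < S w /\ S w < 1)]).
    exact: (measureU0 mSN mVN V01).
  exact: (uniform_given_negligible mZ mS SZ).
exists [set z | law_cdf (k' z) b <= law_cdf (k z) a]; split => //.
- apply: null; first exact: measurable_le_gt_preimage (measurableC mC).
  move=> w [qa bW /= /negP]; rewrite -ltNge => ab.
  have [/andP[V0 V1]|/negP] := boolP (0 <= V w <= 1); last by right.
  left => -[S0 S1]; move: qa; rewrite quantile_map_le// leNgt => /negP; apply.
  apply: (lt_le_trans ab); rewrite SE.
  apply: le_trans (law_cdf_le_left (kernel_law k' (Z w)) bW) _.
  exact: (@dtransform_ge _ (kernel_law k' (Z w))).
- apply: null; first exact: measurable_le_gt_preimage mC.
  move=> w [Wb aq /= ab].
  have [/andP[V0 V1]|/negP] := boolP (0 <= V w <= 1); last by right.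
  left => -[S0 S1]; move: aq; rewrite ltNge quantile_map_le// => /negP; apply.
  apply: le_trans ab; rewrite SE.
  apply: le_trans (le_law_cdf (kernel_law k' (Z w)) Wb).
  exact: (@dtransform_le _ (kernel_law k' (Z w))).
Qed.

End monotone_couplings.

Section uniform_base.
Context d (B : measurableType d) (R : realType).
Variable beta : probability B R.
Local Notation U := (@uniform01 R).

Lemma uniform01_le (c : R) : 0 <= c -> c <= 1 ->
  U [set s | [/\ 0 < s, s < 1 & s <= c]] = c%:E.
Proof.
move=> c0 c1.
have E1 : [set s | [/\ 0 < s, s < 1 & s <= c]] = `]0, 1[%classic `&` `]-oo, c]%classic.
  apply/seteqP; split => s /=; rewrite !in_itv /=; first by move=> [-> -> ->].
  by move=> [/andP[]].
have mE : measurable [set s | [/\ 0 < s, s < 1 & s <= c]].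
  by rewrite E1; exact: measurableI.
have leb_oc : lebesgue_measure (`]0, c]%classic : set R) = c%:E.
  rewrite [LHS](lebesgue_measure_itv `]0, c]) /= lte_fin.
  by case: ltP => [_|c0']; [rewrite sube0|congr (_%:E); lra].
have leb_oo : lebesgue_measure (`]0, c[%classic : set R) = c%:E.
  rewrite [LHS](lebesgue_measure_itv `]0, c[) /= lte_fin.
  by case: ltP => [_|c0']; [rewrite sube0|congr (_%:E); lra].
rewrite uniform01E//; apply/eqP; rewrite eq_le; apply/andP; split.
  rewrite -leb_oc le_measure ?inE//; first exact: measurableI.
  by move=> s [[s0 s1 sc] _] /=; rewrite in_itv /= s0.
rewrite -leb_oo le_measure ?inE//; first exact: measurableI.
move=> s /=; rewrite !in_itv /= => /andP[s0 sc].
by split; [split|apply/andP; split]; lra.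
Qed.

Lemma uniform_given_product : uniform_given (beta \x U)%E fst snd.
Proof.
move=> C s mC ms s01.
pose E := [set w : B * R | [/\ C w.1, 0 < w.2, w.2 < 1 & w.2 <= s w.1]].
transitivity (\int[beta]_b U (xsection E b))%E => //.
rewrite [RHS](eq_measure_integral beta); last first.
  move=> A mA _.
  transitivity ((beta \x U)%E (A `*` setT)); first by rewrite setXT.
  rewrite [LHS]product_measure1E// -[RHS]mule1; congr (_ * _)%E.
  exact: (@probability_setT _ _ _ (@uniform01 R)).
rewrite [RHS]integral_mkcond; apply: eq_integral => b _; rewrite patchE.
have /andP[s0 s1] := s01 b.
case: ifPn => [|/negP] bC; last first.
  rewrite (_ : xsection E b = set0) ?measure0//.
  apply/seteqP; split => // t; rewrite /xsection /= inE => -[Cb _ _ _].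
  by apply: bC; rewrite inE.
rewrite -(uniform01_le s0 s1); congr (U _).
apply/seteqP; split => t; rewrite /xsection /= inE; first by move=> [].
by move=> [? ? ?]; split => //; rewrite inE in bC.
Qed.

End uniform_base.

Section joint_measurability.
Context d (B : measurableType d) (R : realType).
Variable k : R.-pker B ~> R.

(** With the end point of the ray made part of the parameter, a distribution function is the mass of
    a section of one fixed measurable set, hence jointly measurable in the base point and the end
    point. *)
Let kfst (z : B * R) : {measure set R -> \bar R} := k z.1.

Let measurable_kfst A : measurable A -> measurable_fun [set: B * R] (kfst ^~ A).
Proof.
move=> mA; apply: (@measurableT_comp _ _ _ _ _ _ (k ^~ A) _ fst) => //.
exact: measurable_kernel.
Qed.

HB.instance Definition _ := @isKernel.Build _ _ _ _ R kfst measurable_kfst.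

HB.instance Definition _ :=
  @Kernel_isProbability.Build _ _ _ _ R kfst (fun z => prob_kernel z.1).

Lemma measurable_law_cdf2 :
  measurable_fun [set: B * R] (fun z => law_cdf (k z.1) z.2).
Proof.
apply/measurable_EFinP.
pose A := [set x : (B * R) * R | x.2 <= x.1.2].
rewrite (_ : EFin \o _ = fun z => kfst z (xsection A z)).
  apply: measurable_fun_xsection_finite_kernel; rewrite inE.
  apply: measurable_set_pred; apply: measurable_fun_ler => //.
  exact: measurableT_comp.
apply/funext => z; rewrite /= (law_cdfE (kernel_law k z.1)); congr (k _ _).
by apply/seteqP; split => t; rewrite /xsection /= inE in_itv.
Qed.

Lemma measurable_law_cdf_left2 :
  measurable_fun [set: B * R] (fun z => law_cdf_left (k z.1) z.2).
Proof.
apply/measurable_EFinP.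
pose A := [set x : (B * R) * R | x.2 < x.1.2].
rewrite (_ : EFin \o _ = fun z => kfst z (xsection A z)).
  apply: measurable_fun_xsection_finite_kernel; rewrite inE.
  apply: measurable_set_pred; apply: measurable_fun_ltr => //.
  exact: measurableT_comp.
apply/funext => z; rewrite /= (law_cdf_leftE (kernel_law k z.1)); congr (k _ _).
by apply/seteqP; split => t; rewrite /xsection /= inE in_itv.
Qed.

Lemma measurable_dtransform :
  measurable_fun [set: (B * R) * R] (fun x => dtransform (k x.1.1) x.1.2 x.2).
Proof.
have mF : measurable_fun [set: (B * R) * R] (fun x => law_cdf (k x.1.1) x.1.2).
  exact: (measurableT_comp measurable_law_cdf2 measurable_fst).
have mG : measurable_fun [set: (B * R) * R] (fun x => law_cdf_left (k x.1.1) x.1.2).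
  exact: (measurableT_comp measurable_law_cdf_left2 measurable_fst).
apply: measurable_funD => //; apply: measurable_funM => //.
exact: measurable_funB.
Qed.

End joint_measurability.

Section uniform_given_dtransform.
Context d d' (T : measurableType d) (B : measurableType d') (R : realType).
Variables (P : probability T R) (Z : T -> B) (W V : T -> R).
Hypotheses (mZ : measurable_fun [set: T] Z) (mW : measurable_fun [set: T] W).
Hypothesis (mV : measurable_fun [set: T] V).
Variable k : R.-pker B ~> R.
Hypothesis kP : is_disintegration P Z W k.
Local Notation U := (@uniform01 R).
Hypothesis V_uniform : forall (A : set (B * R)) (D : set R),
  measurable A -> measurable D ->
  P [set w | A (Z w, W w) /\ D (V w)] = (P [set w | A (Z w, W w)] * U D)%E.

(** By independence the law of [((Z, W), V)] is a product; Tonelli and the disintegration of [W]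
    given [Z] then reduce the claim to [dtransform_uniform] in each fibre. *)
Lemma uniform_given_dtransform :
  uniform_given P Z (fun w => dtransform (k (Z w)) (W w) (V w)).
Proof.
move=> C s mC ms s01.
pose S (x : (B * R) * R) := dtransform (k x.1.1) x.1.2 x.2.
pose E := [set x : (B * R) * R | [/\ C x.1.1, 0 < S x, S x < 1 & S x <= s x.1.1]].
have mS : measurable_fun [set: (B * R) * R] S by exact: measurable_dtransform.
have mE : measurable E.
  rewrite (_ : E = (fst \o fst) @^-1` C `&`
      [set x | [&& 0 < S x, S x < 1 & S x <= s x.1.1]]); last first.
    apply/seteqP; split => x /=; first by move=> [? -> -> ->].
    by move=> [? /and3P[]].
  apply: measurableI.
    rewrite -[X in measurable X]setTI.
    exact: (measurableT_comp measurable_fst measurable_fst).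
  apply: measurable_set_pred; apply: measurable_and; first exact: measurable_fun_ltr.
  apply: measurable_and; first exact: measurable_fun_ltr.
  apply: measurable_fun_ler => //.
  exact: (measurableT_comp ms (measurableT_comp measurable_fst measurable_fst)).
have mZW : measurable_fun [set: T] (fun w => (Z w, W w)) by exact: measurable_fun_pair.
have mZWV : measurable_fun [set: T] (fun w => ((Z w, W w), V w)).
  exact: measurable_fun_pair.
pose M := image_law P mZW.
transitivity (image_law P mZWV E) => //.
transitivity ((M \x U)%E E).
  apply: (@measure_prod_unique _ _ (B * R)%type R R (image_law P mZWV)
      (M \x U)%E _ _ E mE) => [|A D mA mD].
    by apply: le_lt_trans (ltry 1); exact: probability_le1.
  rewrite [RHS]product_measure1E//.
  exact: V_uniform.
transitivity (\int[M]_x U (xsection E x))%E => //.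
have mUE : measurable_fun [set: B * R] (fun x => U (xsection E x)).
  exact: measurable_fun_xsection.
rewrite integral_image_law// (integral_disintegration mZ mW kP mUE)//.
rewrite [RHS]integral_mkcond; apply: (@eq_integral _ _ _ (image_law P mZ)) => b _.
rewrite patchE.
have /andP[s0 s1] := s01 b.
case: ifPn => [|/negP] bC; last first.
  rewrite integral0_eq// => y _.
  rewrite (_ : xsection E (b, y) = set0) ?measure0//.
  apply/seteqP; split => // t; rewrite /xsection /= inE => -[/= Cb _ _ _].
  by apply: bC; rewrite inE.
rewrite -(dtransform_uniform (kernel_law k b) s0 s1) integral_kernel_law.
apply: eq_integral => y _; congr (U _).
apply/seteqP; split => t; rewrite /xsection /= inE; first by move=> [].
by move=> [? ? ?]; split => //=; rewrite inE in bC.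
Qed.

End uniform_given_dtransform.

(** * Gluing along the pivot measure *)

Lemma integral_uniform01 (R : realType) (f : R -> \bar R) :
  measurable_fun [set: R] f -> (forall s, 0 <= f s)%E ->
  (\int[@uniform01 R]_s f s = \int[lebesgue_measure]_(s in `[0%R, 1%R]) f s)%E.
Proof.
move=> mf f0; transitivity (\int[uniform_prob (@ltr01 R)]_s f s)%E; last first.
  by rewrite integral_uniform// subr0 invr1 mul1e.
(* The identity is a measurable map between the two displays on the line and transports the integral
   from one to the other. *)
have mid := @measurable_id _ (measurableTypeR R) setT.
have := @ge0_integral_pushforward _ _ (measurableTypeR R) R R (fun x => x) mid
  (uniform_prob (@ltr01 R)) setT f measurableT mf (fun x _ => f0 x).
exact.
Qed.

(** For fixed [C] both sides are finite measures in the first factor, determined by rays; rectangles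
    then determine the joint law. *)
Lemma law_pair_unique d1 d2 d (T1 : measurableType d1) (T2 : measurableType d2)
    (B : measurableType d) (R : realType) (P1 : probability T1 R)
    (P2 : probability T2 R) (X1 : T1 -> R) (Z1 : T1 -> B) (X2 : T2 -> R)
    (Z2 : T2 -> B) :
  measurable_fun [set: T1] X1 -> measurable_fun [set: T1] Z1 ->
  measurable_fun [set: T2] X2 -> measurable_fun [set: T2] Z2 ->
  (forall a C, measurable C -> P1 [set w | X1 w <= a /\ C (Z1 w)] =
                               P2 [set w | X2 w <= a /\ C (Z2 w)]) ->
  forall E : set (R * B), measurable E ->
    P1 [set w | E (X1 w, Z1 w)] = P2 [set w | E (X2 w, Z2 w)].
Proof.
move=> mX1 mZ1 mX2 mZ2 H E mE.
have mXZ1 : measurable_fun [set: T1] (fun w => (X1 w, Z1 w)).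
  exact: measurable_fun_pair.
have mXZ2 : measurable_fun [set: T2] (fun w => (X2 w, Z2 w)).
  exact: measurable_fun_pair.
apply: (@measure_prod_unique _ _ R B R (image_law P1 mXZ1) (image_law P2 mXZ2)) => //.
  by apply: le_lt_trans (ltry 1); exact: probability_le1.
move=> A C mA mC.
have mC1 : measurable (Z1 @^-1` C) by rewrite -[X in measurable X]setTI; exact: mZ1.
have mC2 : measurable (Z2 @^-1` C) by rewrite -[X in measurable X]setTI; exact: mZ2.
pose m1 : {measure set R -> \bar R} :=
  measure_function_pushforward__canonical__measure_function_Measure
    (mrestr P1 mC1) mX1.
pose m2 : {measure set R -> \bar R} :=
  measure_function_pushforward__canonical__measure_function_Measure
    (mrestr P2 mC2) mX2.
apply: (@measure_line_unique R m1 m2) => //; last by move=> a; exact: H.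
apply: le_lt_trans (ltry 1); apply: (@probability_le1 _ _ _ P1).
by rewrite preimage_setT setTI.
Qed.

(** * Quantile costs and distances written with a uniform variable *)

Section quantile_cost.
Context d (B : measurableType d) (R : realType).
Variables (h : R -> R) (beta : probability B R) (k1 k2 : R.-pker B ~> R).
Hypothesis h_ge0 : forall x : R, 0 <= h x.
Hypothesis h_convex : @convex_function R R^o [set: R] h.
Hypothesis h0 : h 0 = 0.
Local Notation U := (@uniform01 R).
Local Notation leb := (@lebesgue_measure R).

Let cost (z : B * R) : \bar R :=
  (h `|quantile_map k1 z.1 z.2 - quantile_map k2 z.1 z.2|)%:E.

Let cost_ge0 z : (0 <= cost z)%E.
Proof. by rewrite lee_fin. Qed.

Let measurable_cost : measurable_fun [set: B * R] cost.
Proof.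
apply/measurable_EFinP; apply: measurable_convex_distance => //;
  exact: measurable_quantile_map.
Qed.

(** [quantile] and [quantile_map] agree on the open interval, and its two end points are
    Lebesgue-null. *)
Let integral_fiber b :
  (\int[leb]_(s in `[0%R, 1%R]) (h `|quantile (k1 b) s - quantile (k2 b) s|)%:E =
   \int[U]_s cost (b, s))%E.
Proof.
have mc : measurable_fun [set: R] (fun s => cost (b, s)).
  exact: (measurableT_comp measurable_cost (measurable_pair1 b)).
rewrite integral_uniform01//.
have eqc s : s \in `]0, 1[ -> (h `|quantile (k1 b) s - quantile (k2 b) s|)%:E =
    cost (b, s).
  by rewrite in_itv /= /cost /quantile_map /= => ->.
rewrite integral_itv_bndoo; last first.
  apply: (eq_measurable_fun (fun s => cost (b, s))).
    by move=> s; rewrite inE /= => s01; rewrite eqc.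
  exact: measurable_funTS.
rewrite [RHS]integral_itv_bndoo; last exact: measurable_funTS.
by apply: eq_integral => s; rewrite inE /= => s01; rewrite eqc.
Qed.

Lemma integral_quantile_cost :
  (\int[beta]_b \int[leb]_(s in `[0%R, 1%R])
     (h `|quantile (k1 b) s - quantile (k2 b) s|)%:E =
   \int[beta \x U]_z
     (h `|quantile_map k1 z.1 z.2 - quantile_map k2 z.1 z.2|)%:E)%E.
Proof.
rewrite [RHS](@fubini_tonelli1 _ _ _ _ _ beta U cost)//.
by apply: eq_integral => b _; exact: integral_fiber.
Qed.

End quantile_cost.

Section quantile_distance.
Context d (B : measurableType d) (R : realType).
Variables (k1 k2 : R.-pker B ~> R) (b : B).
Local Notation U := (@uniform01 R).
Local Notation leb := (@lebesgue_measure R).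

Let X k s := quantile_map k b s : R.

Let mX k : measurable_fun [set: R] (X k).
Proof.
exact: (measurableT_comp (measurable_quantile_map k) (measurable_pair1 b)).
Qed.

(** Up to a null set the event is [F'(t) < s <= F(t)], with [F] and [F'] the distribution functions
    of [k b] and [k' b]. The [- 0] matches the hinge layers at [g = 0]. *)
Let U_layer k k' t : U [set s | X k s <= t - 0 /\ t < X k' s] =
  (Num.max 0 (law_cdf (k b) t - law_cdf (k' b) t))%:E.
Proof.
rewrite subr0.
pose E c := [set s : R | [/\ 0 < s, s < 1 & s <= c]].
have mE c : measurable (E c).
  rewrite (_ : E c = [set s | [&& 0 < s, s < 1 & s <= c]]); last first.
    by apply/seteqP; split => s /=; [move=> [-> -> ->]|move=> /and3P[]].
  apply: measurable_set_pred; apply: measurable_and; first exact: measurable_fun_ltr.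
  apply: measurable_and; first exact: measurable_fun_ltr.
  exact: measurable_fun_ler.
have F0 k0 := law_cdf_ge0 (kernel_law k0 b) t.
have F1 k0 := law_cdf_le1 (kernel_law k0 b) t.
set A := [set s | _].
have mA : measurable A.
  apply: measurableI; rewrite -[X in measurable X]setTI.
    exact: (mX k measurableT (measurable_itv `]-oo, t])).
  have := mX k' measurableT (measurable_itv `]t, +oo[).
  by congr measurable; apply/seteqP; split => s /=; rewrite in_itv /= andbT.
have E1C : U (~` E 1) = 0%E.
  have UE1 : U (E 1) = 1%E by exact: uniform01_le.
  transitivity (1 - U (E 1%R))%E; first exact: probability_setC.
  by rewrite UE1 subee.
rewrite (measureDI _ mA (mE 1)) [X in (X + _)%E](_ : _ = 0%E); last first.
  apply: (subset_measure0 _ _ _ E1C); first exact: measurableD.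
    by apply: measurableC.
  by move=> s [].
rewrite add0e (_ : A `&` E 1 = E (law_cdf (k b) t) `\` E (law_cdf (k' b) t)); last first.
  apply/seteqP; split => s /=.
    move=> [[+ +] [s0 s1 _]]; rewrite /X quantile_map_le// ltNge quantile_map_le//.
    by move=> sF /negP sF'; split => // -[].
  move=> [[s0 s1 sF] nE]; split; last by split => //; exact: ltW.
  rewrite /A /= /X quantile_map_le// ltNge quantile_map_le//; split => //.
  by apply/negP => sF'; apply: nE.
have [FF|FF] := leP (law_cdf (k b) t) (law_cdf (k' b) t).
  rewrite (_ : _ `\` _ = set0) ?measure0.
    by congr (_%:E); apply/esym/max_idPl; lra.
  apply/seteqP; split => // s [[s0 s1 sF] nE]; apply: nE; split => //.
  exact: le_trans sF FF.
rewrite measureD ?setIidr//; last 2 first.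
- by move=> s [s0 s1 sF]; split => //; exact: le_trans sF (ltW FF).
- by apply: le_lt_trans (ltry 1); exact: probability_le1.
transitivity ((law_cdf (k b) t)%:E - (law_cdf (k' b) t)%:E)%E.
  by congr (_ - _)%E; [exact: (uniform01_le (F0 k) (F1 k))|
    exact: (uniform01_le (F0 k') (F1 k'))].
rewrite -EFinB; congr (_%:E); apply/esym/max_idPr; lra.
Qed.

(** Both sides measure the area between the two graphs. The distance is split into its two hinges at
    [g = 0], and the layer formula turns integration in [s] into integration in [t]. *)
Lemma integral_quantile_distance :
  (\int[leb]_(s in `[0%R, 1%R]) `|quantile (k1 b) s - quantile (k2 b) s|%:E =
   \int[leb]_t `|law_cdf (k1 b) t - law_cdf (k2 b) t|%:E)%E.
Proof.
have mc : measurable_fun [set: R] (fun s => `|X k1 s - X k2 s|%:E).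
  apply/measurable_EFinP; apply: measurableT_comp => //.
  by apply: measurable_funB; exact: mX.
have mh k k' : measurable_fun [set: R] (fun s => (Num.max 0 (X k' s - X k s - 0))%:E).
  apply/measurable_EFinP; apply: measurable_maxr => //; apply: measurable_funB => //.
  by apply: measurable_funB; exact: mX.
have mF (k k' : R.-pker B ~> R) : measurable_fun [set: R]
    (fun t => (Num.max 0 (law_cdf (k b) t - law_cdf (k' b) t))%:E).
  apply/measurable_EFinP; apply: measurable_maxr => //; apply: measurable_funB.
    exact: (measurable_law_cdf (kernel_law k b)).
  exact: (measurable_law_cdf (kernel_law k' b)).
have max0 (x : R) : (0 <= (Num.max 0 x)%:E)%E by rewrite lee_fin le_max lexx.
have eqc s : s \in `]0, 1[ -> `|quantile (k1 b) s - quantile (k2 b) s|%:E =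
    `|X k1 s - X k2 s|%:E.
  by rewrite in_itv /= /X /quantile_map => ->.
transitivity (\int[U]_s `|X k1 s - X k2 s|%:E)%E.
  rewrite integral_uniform01//.
  rewrite integral_itv_bndoo; last first.
    apply: (eq_measurable_fun (fun s => `|X k1 s - X k2 s|%:E)).
      by move=> s; rewrite inE /= => s01; rewrite eqc.
    exact: measurable_funTS.
  rewrite [RHS]integral_itv_bndoo; last exact: measurable_funTS.
  by apply: eq_integral => s; rewrite inE /= => s01; rewrite eqc.
transitivity (\int[U]_s ((Num.max 0 (X k2 s - X k1 s - 0))%:E +
    (Num.max 0 (X k1 s - X k2 s - 0))%:E))%E.
  apply: eq_integral => s _; rewrite -EFinD -hinge_distance// subr0.
  by congr (_%:E); apply/esym/max_idPr.
rewrite ge0_integralD//.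
rewrite (integral_hinge_layers _ (mX k1) (mX k2)).
rewrite (integral_hinge_layers _ (mX k2) (mX k1)).
rewrite -ge0_integralD//; first last.
- exact: measurable_hinge_layer.
- exact: measurable_hinge_layer.
apply: eq_integral => t _.
transitivity ((Num.max 0 (law_cdf (k1 b) t - law_cdf (k2 b) t))%:E +
    (Num.max 0 (law_cdf (k2 b) t - law_cdf (k1 b) t))%:E)%E.
  by congr (_ + _)%E; exact: U_layer.
rewrite -EFinD; congr (_%:E).
have := @hinge_distance R (law_cdf (k2 b) t) (law_cdf (k1 b) t) 0 (lexx 0).
rewrite !subr0 => <-; rewrite distrC; apply/max_idPr; exact: normr_ge0.
Qed.

End quantile_distance.

(** Conditional quantiles at a conditionally uniform variable reproduce the joint law of [q] and
    [p]: both sides are integrals of [k b] on a ray, against laws of [Z] and [p] that coincide. *)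
Lemma quantile_map_marginal d d' d3 (T : measurableType d) (B : measurableType d')
    (T' : measurableType d3) (R : realType) (P : probability T R) (Z : T -> B)
    (S : T -> R) (m : probability T' R) (p : T' -> B) (q : T' -> R)
    (k : R.-pker B ~> R) :
  measurable_fun [set: T] Z -> measurable_fun [set: T] S ->
  uniform_given P Z S -> is_disintegration m p q k ->
  measurable_fun [set: T'] p ->
  (forall C, measurable C -> P (Z @^-1` C) = m (p @^-1` C)) ->
  forall a C, measurable C ->
    P [set w | quantile_map k (Z w) (S w) <= a /\ C (Z w)] =
    m [set w | q w <= a /\ C (p w)].
Proof.
move=> mZ mS SZ mk mp PZ a C mC.
rewrite (quantile_map_law mZ mS SZ)//.
transitivity (m (p @^-1` C `&` q @^-1` `]-oo, a]%classic)); last first.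
  by congr (m _); apply/seteqP; split => w /=; rewrite in_itv /= => -[].
rewrite mk//.
apply: (@eq_measure_integral _ _ _ _ (image_law m mp) (image_law P mZ)) => A mA _.
exact: PZ.
Qed.

Lemma measurable_le_preimage d d' (T : measurableType d) (B : measurableType d')
    (R : realType) (X : T -> R) (Z : T -> B) (C : set B) (a : R) :
  measurable_fun [set: T] X -> measurable_fun [set: T] Z -> measurable C ->
  measurable [set w | X w <= a /\ C (Z w)].
Proof.
move=> mX mZ mC; apply: measurableI; rewrite -[X in measurable X]setTI.
  by have := mX measurableT `]-oo, a]%classic (measurable_itv _).
exact: mZ.
Qed.

(** * Comparison of flows, quantile costs and couplings through the pivot *)

Section pivot_transport.
Variables (R : realType) (h : R -> R).
Hypothesis h_ge0 : forall x : R, 0 <= h x.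
Hypothesis h_convex : @convex_function R R^o [set: R] h.
Hypothesis h0 : h 0 = 0.
Variables (mu nu zeta : probability (R * R)%type R).
Local Notation U := (@uniform01 R).
Local Notation leb := (@lebesgue_measure R).

Let m1fst := @measurable_fst _ _ R R.
Let m1snd := @measurable_snd _ _ R R.

Let m11 d (T : measurableType d) :
  measurable_fun [set: (R * R) * T] (fun z : (R * R) * T => z.1.1).
Proof. exact: (measurableT_comp measurable_fst measurable_fst). Qed.
Let m12 d (T : measurableType d) :
  measurable_fun [set: (R * R) * T] (fun z : (R * R) * T => z.1.2).
Proof. exact: (measurableT_comp measurable_snd measurable_fst). Qed.
Let m21 d (T : measurableType d) :
  measurable_fun [set: T * (R * R)] (fun z : T * (R * R) => z.2.1).
Proof. exact: (measurableT_comp measurable_fst measurable_snd). Qed.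
Let m22 d (T : measurableType d) :
  measurable_fun [set: T * (R * R)] (fun z : T * (R * R) => z.2.2).
Proof. exact: (measurableT_comp measurable_snd measurable_snd). Qed.

Let measurable_cost d (T : measurableType d) (X Y : T -> R) :
  measurable_fun [set: T] X -> measurable_fun [set: T] Y ->
  measurable_fun [set: T] (fun w => (h `|X w - Y w|)%:E).
Proof. by move=> mX mY; apply/measurable_EFinP; exact: measurable_convex_distance. Qed.

Let integral_separable_cost (pi : probability ((R * R) * (R * R))%type R) :
  (\int[pi]_z (separable_cost h z.1 z.2)%:E =
   \int[pi]_z (h `|z.1.1 - z.2.1|)%:E + \int[pi]_z (h `|z.1.2 - z.2.2|)%:E)%E.
Proof.
rewrite -ge0_integralD//; try by move=> z _; rewrite lee_fin.
- by apply: measurable_cost; apply: measurableT_comp.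
- by apply: measurable_cost; apply: measurableT_comp.
Qed.

Lemma flow_cost_le_transport_cost (f : flow_pair R) : optimal_flow h mu nu f ->
  (flow_cost h f <= transport_cost (separable_cost h) mu nu)%E.
Proof.
move=> [_ f_opt]; apply: le_ereal_inf_tmp => _ [pi [pi1 pi2] <-].
have mp1 : measurable_fun [set: (R * R) * (R * R)]
    (fun z : (R * R) * (R * R) => (z.1, z.2.1)).
  by apply: measurable_fun_pair => //; exact: measurableT_comp.
have mp2 : measurable_fun [set: (R * R) * (R * R)]
    (fun z : (R * R) * (R * R) => (z.1.2, z.2)).
  by apply: measurable_fun_pair => //; exact: measurableT_comp.
pose g : flow_pair R := (image_law pi mp1, image_law pi mp2).
have /f_opt /le_trans : cardinal_flows mu nu g.
  by split => A mA; [rewrite -pi1|rewrite -pi2|].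
apply.
have g1E : (\int[g.1]_z (h `|z.1.1 - z.2|)%:E = \int[pi]_z (h `|z.1.1 - z.2.1|)%:E)%E.
  apply: (integral_image_law pi mp1 (g := fun z => (h `|z.1.1 - z.2|)%:E)) => [|z].
    exact: (measurable_cost (@m11 _ R) measurable_snd).
  by rewrite lee_fin.
have g2E : (\int[g.2]_z (h `|z.1 - z.2.2|)%:E = \int[pi]_z (h `|z.1.2 - z.2.2|)%:E)%E.
  apply: (integral_image_law pi mp2 (g := fun z => (h `|z.1 - z.2.2|)%:E)) => [|z].
    exact: (measurable_cost measurable_fst (@m22 _ R)).
  by rewrite lee_fin.
by rewrite /flow_cost g1E g2E integral_separable_cost.
Qed.

Variables (mu_x2 zeta_x2 zeta_y1 nu_y1 : R.-pker R ~> R).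
Hypothesis mu_x2P : is_disintegration mu snd fst mu_x2.
Hypothesis zeta_x2P : is_disintegration zeta snd fst zeta_x2.
Hypothesis zeta_y1P : is_disintegration zeta fst snd zeta_y1.
Hypothesis nu_y1P : is_disintegration nu fst snd nu_y1.
Hypothesis zeta_mu : forall C, measurable C -> zeta (snd @^-1` C) = mu (snd @^-1` C).
Hypothesis zeta_nu : forall C, measurable C -> zeta (fst @^-1` C) = nu (fst @^-1` C).

Let quantile_cost1 : \bar R := (\int[pushforward mu snd]_x2
  \int[leb]_(s in `[0%R, 1%R])
    (h `|quantile (mu_x2 x2) s - quantile (zeta_x2 x2) s|)%:E)%E.

Let quantile_cost2 : \bar R := (\int[pushforward nu fst]_y1
  \int[leb]_(t in `[0%R, 1%R])
    (h `|quantile (zeta_y1 y1) t - quantile (nu_y1 y1) t|)%:E)%E.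

Let beta1 := image_law mu m1snd.
Let beta2 := image_law nu m1fst.
(** Under [Q1] and [Q2] a base point comes with a single uniform variable, which feeds both
    conditional quantile maps and so couples them monotonically. *)
Let Q1 : probability (R * R)%type R := (beta1 \x U)%E.
Let Q2 : probability (R * R)%type R := (beta2 \x U)%E.

Let quantile_cost1E : quantile_cost1 =
  (\int[Q1]_z (h `|quantile_map mu_x2 z.1 z.2 - quantile_map zeta_x2 z.1 z.2|)%:E)%E.
Proof. exact: (@integral_quantile_cost _ _ _ _ beta1). Qed.

Let quantile_cost2E : quantile_cost2 =
  (\int[Q2]_z (h `|quantile_map zeta_y1 z.1 z.2 - quantile_map nu_y1 z.1 z.2|)%:E)%E.
Proof. exact: (@integral_quantile_cost _ _ _ _ beta2). Qed.

Let Q1_unif : uniform_given Q1 fst snd := @uniform_given_product _ _ _ beta1.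
Let Q2_unif : uniform_given Q2 fst snd := @uniform_given_product _ _ _ beta2.

Let Q1_fst C : measurable C -> Q1 (fst @^-1` C) = mu (snd @^-1` C).
Proof.
move=> mC; transitivity ((beta1 \x U)%E (C `*` setT)); first by rewrite setXT.
rewrite [LHS]product_measure1E// -[RHS]mule1; congr (_ * _)%E.
exact: (@probability_setT _ _ _ U).
Qed.

Let Q2_fst C : measurable C -> Q2 (fst @^-1` C) = nu (fst @^-1` C).
Proof.
move=> mC; transitivity ((beta2 \x U)%E (C `*` setT)); first by rewrite setXT.
rewrite [LHS]product_measure1E// -[RHS]mule1; congr (_ * _)%E.
exact: (@probability_setT _ _ _ U).
Qed.

Let Q1_mu a C : measurable C ->
  Q1 [set z | quantile_map mu_x2 z.1 z.2 <= a /\ C z.1] =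
  mu [set w | w.1 <= a /\ C w.2].
Proof. exact: (quantile_map_marginal _ _ Q1_unif mu_x2P). Qed.

Let Q1_zeta a C : measurable C ->
  Q1 [set z | quantile_map zeta_x2 z.1 z.2 <= a /\ C z.1] =
  zeta [set w | w.1 <= a /\ C w.2].
Proof.
apply: (quantile_map_marginal _ _ Q1_unif zeta_x2P) => // D mD.
by rewrite zeta_mu// -Q1_fst.
Qed.

Let Q2_zeta a C : measurable C ->
  Q2 [set z | quantile_map zeta_y1 z.1 z.2 <= a /\ C z.1] =
  zeta [set w | w.2 <= a /\ C w.1].
Proof.
apply: (quantile_map_marginal _ _ Q2_unif zeta_y1P) => // D mD.
by rewrite zeta_nu// -Q2_fst.
Qed.

Let Q2_nu a C : measurable C ->
  Q2 [set z | quantile_map nu_y1 z.1 z.2 <= a /\ C z.1] =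
  nu [set w | w.2 <= a /\ C w.1].
Proof. exact: (quantile_map_marginal _ _ Q2_unif nu_y1P). Qed.

(** Each component of the flow competes with a quantile coupling: under [f.1], the pairs [(x1, x2)]
    and [(y1, x2)] have laws [mu] and [zeta]; under [f.2], the pairs [(y1, x2)] and [(y1, y2)] have
    laws [zeta] and [nu]. *)
Lemma quantile_cost_le_flow_cost (f : flow_pair R) : cardinal_flows mu nu f ->
  same_measure (pushforward f.1 (@pivot_proj1 R)) zeta ->
  same_measure (pushforward f.2 (@pivot_proj2 R)) zeta ->
  (quantile_cost1 + quantile_cost2 <= flow_cost h f)%E.
Proof.
move=> [f1 f2 _] f1z f2z; apply: leeD.
- rewrite quantile_cost1E.
  apply: (@monotone_rearrangement_optimal R h _ _ _ _ _ R Q1 f.1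
    (fun z => quantile_map mu_x2 z.1 z.2) (fun z => quantile_map zeta_x2 z.1 z.2)
    (fun z => z.1.1) (fun z => z.2) fst (fun z => z.1.2)) => //;
    try exact: measurable_quantile_map.
  + exact: m11.
  + exact: measurable_snd.
  + exact: m12.
  + move=> a C mC; apply: etrans (Q1_mu a mC) _; symmetry.
    exact: (f1 _ (measurable_le_preimage a m1fst m1snd mC)).
  + move=> a C mC; apply: etrans (Q1_zeta a mC) _; symmetry.
    exact: (f1z _ (measurable_le_preimage a m1fst m1snd mC)).
  + by move=> a b; exact: (quantile_map_pair_monotone _ _ Q1_unif).
- rewrite quantile_cost2E.
  apply: (@monotone_rearrangement_optimal R h _ _ _ _ _ R Q2 f.2
    (fun z => quantile_map zeta_y1 z.1 z.2) (fun z => quantile_map nu_y1 z.1 z.2)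
    (fun z => z.1) (fun z => z.2.2) fst (fun z => z.2.1)) => //;
    try exact: measurable_quantile_map.
  + exact: measurable_fst.
  + exact: m22.
  + exact: m21.
  + move=> a C mC; apply: etrans (Q2_zeta a mC) _; symmetry.
    exact: (f2z _ (measurable_le_preimage a m1snd m1fst mC)).
  + move=> a C mC; apply: etrans (Q2_nu a mC) _; symmetry.
    exact: (f2 _ (measurable_le_preimage a m1snd m1fst mC)).
  + by move=> a b; exact: (quantile_map_pair_monotone _ _ Q2_unif).
Qed.

(* Law of [((y1, x2), (u, v))] with [u] and [v] uniform and independent of
   [(y1, x2)], which has law [zeta]. *)
Let glued : probability ((R * R) * (R * R))%type R :=
  (zeta \x (U \x U : probability (R * R)%type R))%E.

Let gluedX (A B : set (R * R)) : measurable A -> measurable B ->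
  glued (A `*` B) = (zeta A * (U \x U) B)%E.
Proof. by move=> mA mB; rewrite [LHS]product_measure1E. Qed.

Let glued_fst (A : set (R * R)) : measurable A -> glued [set w | A w.1] = zeta A.
Proof.
move=> mA; transitivity (glued (A `*` setT)); first by rewrite setXT.
rewrite gluedX// -[RHS]mule1; congr (_ * _)%E.
exact: (@probability_setT _ _ _ (U \x U : probability (R * R)%type R)%E).
Qed.

Let glued_fst_u (A : set (R * R)) (D : set R) : measurable A -> measurable D ->
  glued [set w | A w.1 /\ D w.2.1] = (glued [set w | A w.1] * U D)%E.
Proof.
move=> mA mD; rewrite glued_fst//.
transitivity (glued (A `*` (D `*` setT))).
  by congr (glued _); apply/seteqP; split => w /=; [move=> []|move=> [? []]].
rewrite gluedX//; last exact: measurableX.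
congr (_ * _)%E; rewrite [LHS]product_measure1E// -[RHS]mule1; congr (_ * _)%E.
exact: (@probability_setT _ _ _ U).
Qed.

Let glued_fst_v (A : set (R * R)) (D : set R) : measurable A -> measurable D ->
  glued [set w | A w.1 /\ D w.2.2] = (glued [set w | A w.1] * U D)%E.
Proof.
move=> mA mD; rewrite glued_fst//.
transitivity (glued (A `*` (setT `*` D))).
  by congr (glued _); apply/seteqP; split => w /=; [move=> []|move=> [? []]].
rewrite gluedX//; last exact: measurableX.
congr (_ * _)%E; rewrite [LHS]product_measure1E// -[RHS]mul1e; congr (_ * _)%E.
exact: (@probability_setT _ _ _ U).
Qed.

(** In the coordinates [((y1, x2), (u, v))], [S1] randomizes [y1] by [u] to be uniform given [x2],
    and [S2] randomizes [x2] by [v] to be uniform given [y1]. *)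
Let S1 (w : (R * R) * (R * R)) : R := dtransform (zeta_x2 w.1.2) w.1.1 w.2.1.
Let S2 (w : (R * R) * (R * R)) : R := dtransform (zeta_y1 w.1.1) w.1.2 w.2.2.

Let mS1 : measurable_fun [set: (R * R) * (R * R)] S1.
Proof.
have mw : measurable_fun [set: (R * R) * (R * R)]
    (fun w : (R * R) * (R * R) => ((w.1.2, w.1.1), w.2.1)).
  apply: measurable_fun_pair; last exact: m21.
  by apply: measurable_fun_pair; [exact: m12|exact: m11].
exact: (measurableT_comp (measurable_dtransform zeta_x2) mw).
Qed.

Let mS2 : measurable_fun [set: (R * R) * (R * R)] S2.
Proof.
have mw : measurable_fun [set: (R * R) * (R * R)]
    (fun w : (R * R) * (R * R) => (w.1, w.2.2)).
  by apply: measurable_fun_pair; [exact: measurable_fst|exact: m22].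
exact: (measurableT_comp (measurable_dtransform zeta_y1) mw).
Qed.

Let m11' := @m11 _ (R * R)%type.
Let m12' := @m12 _ (R * R)%type.
Let m21' := @m21 _ (R * R)%type.
Let m22' := @m22 _ (R * R)%type.

Let glued_unif1 : uniform_given glued (fun w => w.1.2) S1.
Proof.
(* Points of [zeta] are [(y1, x2)], whereas [uniform_given_dtransform] puts the conditioning
   variable, here [x2], first. *)
have mswap : measurable_fun [set: R * R] (fun w : R * R => (w.2, w.1)).
  by apply: measurable_fun_pair.
apply: (@uniform_given_dtransform _ _ _ _ R glued (fun w => w.1.2)
  (fun w => w.1.1) (fun w => w.2.1) m12' m11' m21' zeta_x2).
- move=> C A mC mA.
  have mCA : measurable (snd @^-1` C `&` fst @^-1` A : set (R * R)).
    by apply: measurableI; rewrite -[X in measurable X]setTI;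
      [exact: m1snd|exact: m1fst].
  transitivity (glued [set w | (snd @^-1` C `&` fst @^-1` A) w.1]) => //.
  rewrite glued_fst// zeta_x2P//.
  apply: (@eq_measure_integral _ _ _ _ (image_law glued m12') (image_law zeta m1snd)).
  move=> D mD _; apply: esym; apply: (@glued_fst (snd @^-1` D)).
  by rewrite -[X in measurable X]setTI; exact: m1snd.
- move=> A D mA mD.
  have mA' : measurable [set w : R * R | A (w.2, w.1)].
    by rewrite -[X in measurable X]setTI; exact: mswap.
  exact: (glued_fst_u mA' mD).
Qed.

Let glued_unif2 : uniform_given glued (fun w => w.1.1) S2.
Proof.
apply: (@uniform_given_dtransform _ _ _ _ R glued (fun w => w.1.1)
  (fun w => w.1.2) (fun w => w.2.2) m11' m12' m22' zeta_y1).
- move=> C A mC mA.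
  have mCA : measurable (fst @^-1` C `&` snd @^-1` A : set (R * R)).
    by apply: measurableI; rewrite -[X in measurable X]setTI;
      [exact: m1fst|exact: m1snd].
  transitivity (glued [set w | (fst @^-1` C `&` snd @^-1` A) w.1]) => //.
  rewrite glued_fst// zeta_y1P//.
  apply: (@eq_measure_integral _ _ _ _ (image_law glued m11') (image_law zeta m1fst)).
  move=> D mD _; apply: esym; apply: (@glued_fst (fst @^-1` D)).
  by rewrite -[X in measurable X]setTI; exact: m1fst.
- move=> A D mA mD.
  have AE (w : (R * R) * (R * R)) : A (w.1.1, w.1.2) = A w.1 by case: w => -[].
  have := glued_fst_v mA mD.
  by under eq_set do rewrite -AE; under [in X in _ = X -> _]eq_set do rewrite -AE.
Qed.

(** The two missing coordinates: [(X1, x2)] will have law [mu] and [(y1, Y2)] law [nu]. *)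
Let X1 (w : (R * R) * (R * R)) : R := quantile_map mu_x2 w.1.2 (S1 w).
Let Y2 (w : (R * R) * (R * R)) : R := quantile_map nu_y1 w.1.1 (S2 w).

Let mX1 : measurable_fun [set: (R * R) * (R * R)] X1.
Proof. exact: (measurable_quantile_map_given m12' mS1). Qed.

Let mY2 : measurable_fun [set: (R * R) * (R * R)] Y2.
Proof. exact: (measurable_quantile_map_given m11' mS2). Qed.

Let glued_mu a C : measurable C ->
  glued [set w | X1 w <= a /\ C w.1.2] = mu [set w | w.1 <= a /\ C w.2].
Proof.
apply: (quantile_map_marginal m12' mS1 glued_unif1 mu_x2P) => // D mD.
rewrite -zeta_mu//; apply: (@glued_fst (snd @^-1` D)).
by rewrite -[X in measurable X]setTI; exact: m1snd.
Qed.

Let glued_nu a C : measurable C ->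
  glued [set w | Y2 w <= a /\ C w.1.1] = nu [set w | w.2 <= a /\ C w.1].
Proof.
apply: (quantile_map_marginal m11' mS2 glued_unif2 nu_y1P) => // D mD.
rewrite -zeta_nu//; apply: (@glued_fst (fst @^-1` D)).
by rewrite -[X in measurable X]setTI; exact: m1fst.
Qed.

Let U_out : U (~` `[0, 1]%classic) = 0%E.
Proof.
by rewrite uniform01E; [rewrite setICl measure0|exact: measurableC].
Qed.

(** Given [x2], the pair [(X1, y1)] is monotone, and its two marginals jointly with [x2] are those
    of the quantile pair under [Q1]. *)
Let glued_cost1 : (\int[glued]_w (h `|X1 w - w.1.1|)%:E <= quantile_cost1)%E.
Proof.
rewrite quantile_cost1E.
apply: (@monotone_rearrangement_optimal R h _ _ _ _ _ R glued Q1 X1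
  (fun w => w.1.1) (fun z => quantile_map mu_x2 z.1 z.2)
  (fun z => quantile_map zeta_x2 z.1 z.2) (fun w => w.1.2) fst) => //;
  try exact: measurable_quantile_map.
- by move=> a C mC; apply: etrans (glued_mu a mC) _; rewrite -Q1_mu.
- move=> a C mC; apply: etrans (esym (Q1_zeta a mC)).
  exact: (glued_fst (measurable_le_preimage a m1fst m1snd mC)).
- move=> a b; apply: (@quantile_map_dtransform_monotone _ _ _ _ _ glued _ S1
    m12' mS1 glued_unif1 mu_x2 zeta_x2 _ (fun w => w.2.1)) => //.
  have := glued_fst_u measurableT (measurableC (measurable_itv `[0, 1])).
  rewrite U_out mule0 => <-; congr (glued _); apply/seteqP.
  by split => w /=; rewrite in_itv /=; [move=> ?; split|move=> []].
Qed.

Let glued_cost2 : (\int[glued]_w (h `|w.1.2 - Y2 w|)%:E <= quantile_cost2)%E.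
Proof.
rewrite quantile_cost2E.
(* The quantile variable [Y2] is moved to the first place, as in
   [quantile_map_dtransform_monotone]. *)
under eq_integral do rewrite distrC.
under [leRHS]eq_integral do rewrite distrC.
apply: (@monotone_rearrangement_optimal R h _ _ _ _ _ R glued Q2 Y2
  (fun w => w.1.2) (fun z => quantile_map nu_y1 z.1 z.2)
  (fun z => quantile_map zeta_y1 z.1 z.2) (fun w => w.1.1) fst) => //;
  try exact: measurable_quantile_map.
- by move=> a C mC; apply: etrans (glued_nu a mC) _; rewrite -Q2_nu.
- move=> a C mC; apply: etrans (esym (Q2_zeta a mC)).
  exact: (glued_fst (measurable_le_preimage a m1snd m1fst mC)).
- move=> a b; apply: (@quantile_map_dtransform_monotone _ _ _ _ _ glued _ S2
    m11' mS2 glued_unif2 nu_y1 zeta_y1 _ (fun w => w.2.2)) => //.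
  have := glued_fst_v measurableT (measurableC (measurable_itv `[0, 1])).
  rewrite U_out mule0 => <-; congr (glued _); apply/seteqP.
  by split => w /=; rewrite in_itv /=; [move=> ?; split|move=> []].
Qed.

(** The law of [((X1, x2), (y1, Y2))] is a coupling of [mu] and [nu], and the separable cost splits
    into the two glued costs. *)
Lemma transport_cost_le_quantile_cost :
  (transport_cost (separable_cost h) mu nu <= quantile_cost1 + quantile_cost2)%E.
Proof.
have mpi : measurable_fun [set: (R * R) * (R * R)]
    (fun w : (R * R) * (R * R) => ((X1 w, w.1.2), (w.1.1, Y2 w))).
  apply: measurable_fun_pair; apply: measurable_fun_pair.
  - exact: mX1.
  - exact: m12'.
  - exact: m11'.
  - exact: mY2.
pose pi := image_law glued mpi.
apply: (@le_trans _ _ (\int[pi]_z (separable_cost h z.1 z.2)%:E)%E).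
  apply: ereal_inf_lbound; exists pi => //; split => A mA.
    transitivity (glued [set w | A (X1 w, w.1.2)]) => //.
    rewrite (law_pair_unique mX1 m12' m1fst m1snd glued_mu)//.
    by congr (mu _); apply/seteqP; split => -[].
  transitivity (glued [set w | A (w.1.1, Y2 w)]) => //.
  have mA' : measurable [set w : R * R | A (w.2, w.1)].
    have mswap : measurable_fun [set: R * R] (fun w : R * R => (w.2, w.1)).
      by apply: measurable_fun_pair.
    by rewrite -[X in measurable X]setTI; exact: mswap.
  apply: etrans (law_pair_unique mY2 m11' m1snd m1fst glued_nu mA') _.
  by congr (nu _); apply/seteqP; split => -[].
rewrite integral_separable_cost; apply: leeD.
  have -> := integral_image_law glued mpi
    (measurable_cost m11' m21') (fun z => h_ge0 `|z.1.1 - z.2.1|).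
  exact: glued_cost1.
have -> := integral_image_law glued mpi
  (measurable_cost m12' m22') (fun z => h_ge0 `|z.1.2 - z.2.2|).
exact: glued_cost2.
Qed.

End pivot_transport.

Theorem theorem8 (R : realType) (h : R -> R)
    (h_ge0 : forall x : R, 0 <= h x)
    (h_convex : @convex_function R R^o [set: R] h)
    (h0 : h 0 = 0)
    (mu nu zeta : probability (R * R)%type R)
    (zeta_pivot : is_pivot h mu nu zeta)
    (mu_x2 zeta_x2 zeta_y1 nu_y1 : R.-pker R ~> R)
    (mu_x2P : is_disintegration mu snd fst mu_x2)
    (zeta_x2P : is_disintegration zeta snd fst zeta_x2)
    (zeta_y1P : is_disintegration zeta fst snd zeta_y1)
    (nu_y1P : is_disintegration nu fst snd nu_y1) :
  transport_cost (separable_cost h) mu nu =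
    (\int[pushforward mu snd]_x2
       \int[lebesgue_measure]_(s in `[0%R, 1%R])
         (h `|quantile (mu_x2 x2) s - quantile (zeta_x2 x2) s|)%:E
     + \int[pushforward nu fst]_y1
       \int[lebesgue_measure]_(t in `[0%R, 1%R])
         (h `|quantile (zeta_y1 y1) t - quantile (nu_y1 y1) t|)%:E)%E
  /\
  ((forall x : R, h x = `|x|) ->
   W1 mu nu =
    (\int[pushforward mu snd]_x2
       \int[lebesgue_measure]_s
         `|law_cdf (mu_x2 x2) s - law_cdf (zeta_x2 x2) s|%:E
     + \int[pushforward nu fst]_y1
       \int[lebesgue_measure]_t
         `|law_cdf (zeta_y1 y1) t - law_cdf (nu_y1 y1) t|%:E)%E).
Proof.
move: zeta_pivot => [f [f_opt f1z f2z]].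
have [f_flow _] := f_opt; have [f1 f2 _] := f_flow.
(* Both [mu] and [zeta] are projections of [f.1] that retain [x2]; likewise [nu] and [zeta] are
   projections of [f.2] that retain [y1]. *)
have zeta_mu C : measurable C -> zeta (snd @^-1` C) = mu (snd @^-1` C).
  move=> mC; have mC' : measurable (snd @^-1` C : set (R * R)).
    by rewrite -[X in measurable X]setTI; exact: measurable_snd.
  by rewrite -f1z// -f1.
have zeta_nu C : measurable C -> zeta (fst @^-1` C) = nu (fst @^-1` C).
  move=> mC; have mC' : measurable (fst @^-1` C : set (R * R)).
    by rewrite -[X in measurable X]setTI; exact: measurable_fst.
  by rewrite -f2z// -f2.
have costE : transport_cost (separable_cost h) mu nu =
    (\int[pushforward mu snd]_x2
       \int[lebesgue_measure]_(s in `[0%R, 1%R])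
         (h `|quantile (mu_x2 x2) s - quantile (zeta_x2 x2) s|)%:E
     + \int[pushforward nu fst]_y1
       \int[lebesgue_measure]_(t in `[0%R, 1%R])
         (h `|quantile (zeta_y1 y1) t - quantile (nu_y1 y1) t|)%:E)%E.
  apply/eqP; rewrite eq_le; apply/andP; split.
    exact: (@transport_cost_le_quantile_cost R h h_ge0 h_convex h0 mu nu zeta).
  apply: le_trans (flow_cost_le_transport_cost h_ge0 h_convex h0 f_opt).
  exact: (@quantile_cost_le_flow_cost R h h_ge0 h_convex h0 mu nu zeta).
split; first exact: costE.
move=> habs.
have -> : W1 mu nu = transport_cost (separable_cost h) mu nu.
  rewrite /W1; congr transport_cost; apply/funext => x; apply/funext => y.
  by rewrite /separable_cost !habs !normr_id.
(* It remains to replace, fibre by fibre, the distance of quantiles by the distance of distribution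
   functions. *)
rewrite costE; congr (_ + _)%E.
  apply: (@eq_integral _ _ _ (image_law mu measurable_snd)) => x2 _.
  rewrite -integral_quantile_distance.
  by apply: eq_integral => s _; rewrite habs normr_id.
apply: (@eq_integral _ _ _ (image_law nu measurable_fst)) => y1 _.
rewrite -integral_quantile_distance.
by apply: eq_integral => s _; rewrite habs normr_id.
Qed.
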